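(* Suppose the following hold. (1) The sets $\mathbb{U}$, $\mathbb{W}$, $\mathbb{Z}$, $\mathbb{X}_f$ are closed, convex, and contain the origin; $\mathbb{U}$ and $\mathbb{W}$ are bounded; and $\mathbb{W}$ contains the origin in its interior. (2) $Q,R,P\succeq 0$. (3) $Q\succ 0$, and either $\mathcal{X}$ is bounded or $\mathbb{X}_f=\mathbb{R}^n$. (4) $R,P\succ 0$ and $P=A'PA-A'PB(R+B'PB)^{-1}B'PA+Q$; with $K_f:=-(R+B'PB)^{-1}B'PA$, one has $(x,K_fx)\in\mathbb{Z}$ and $(A+BK_f)x+Gw\in\mathbb{X}_f$ for all $x\in\mathbb{X}_f$ and $w\in\mathbb{W}$; and $\mathbb{X}_f$ contains the origin in its interior. Then $$\lim_{k\to\infty}\mathcal{J}_k(x,d,\mathbb{P})=\mathrm{tr}(G'PG\Sigma)\quad\text{with }\Sigma=\mathbb{E}_{\mathbb{P}}[w(i)w(i)']$$ for all $x\in\mathcal{X}$, $d\in\mathcal{D}$, and $\mathbb{P}\in\mathcal{Q}$.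
   Context: System: $x^+=Ax+Bu+Gw$ with $A\in\mathbb{R}^{n\times n}$, $B\in\mathbb{R}^{n\times m}$, $G\in\mathbb{R}^{n\times q}$, input set $\mathbb{U}\subseteq\mathbb{R}^m$, disturbance set $\mathbb{W}\subseteq\mathbb{R}^q$, state-input constraint set $\mathbb{Z}\subseteq\mathbb{R}^n\times\mathbb{U}$, terminal set $\mathbb{X}_f\subseteq\mathbb{R}^n$, horizon $N\ge 1$. A prime denotes transpose; positive (semi)definite matrices are symmetric. Policies: $\Theta$ is the set of pairs $\theta=(\mathbf{M},\mathbf{v})$ with $\mathbf{v}=(v(0),\dots,v(N-1))\in\mathbb{R}^{Nm}$ and $\mathbf{M}\in\mathbb{R}^{Nm\times Nq}$ having blocks $M(i,j)\in\mathbb{R}^{m\times q}$ ($0\le i,j\le N-1$) with $M(i,j)=0$ for $j\ge i$. Given $x\in\mathbb{R}^n$, $\theta\in\Theta$, $\mathbf{w}=(w(0),\dots,w(N-1))$, put $u(i)=v(i)+\sum_{j=0}^{i-1}M(i,j)w(j)$, $x(0)=x$, $x(i+1)=Ax(i)+Bu(i)+Gw(i)$. $\Pi(x)$ is the set of $\theta\in\Theta$ such that for all $\mathbf{w}\in\mathbb{W}^N$: $(x(k),u(k))\in\mathbb{Z}$ for $k=0,\dots,N-1$ and $x(N)\in\mathbb{X}_f$. Feasible set: $\mathcal{X}=\{x\in\mathbb{R}^n:\Pi(x)\ne\emptyset\}$. Cost: $\ell(x,u)=x'Qx+u'Ru$, $V_f(x)=x'Px$, $J(x,\theta,\mathbf{w})=\sum_{k=0}^{N-1}\ell(x(k),u(k))+V_f(x(N))$.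 Ambiguity: $\mathcal{M}(S)$ is the set of probability distributions with zero mean for which the random variable lies in $S$ with probability one. For $d=(\varepsilon,\widehat\Sigma)$ with $\varepsilon\ge 0$, $\widehat\Sigma\succeq 0$ in $\mathbb{R}^{q\times q}$, let $\mathbb{B}_d=\{\Sigma\succeq 0:\mathrm{tr}(\widehat\Sigma+\Sigma-2(\widehat\Sigma^{1/2}\Sigma\widehat\Sigma^{1/2})^{1/2})\le\varepsilon^2\}$ and $\mathcal{P}_d=\{\mathbb{P}\in\mathcal{M}(\mathbb{W}):\mathbb{E}_{\mathbb{P}}[ww']\in\mathbb{B}_d\}$. $\mathcal{D}$ is the set of all such $d$ for which every $\Sigma\in\mathbb{B}_d$ equals $\mathbb{E}_{\mathbb{P}}[ww']$ for some $\mathbb{P}\in\mathcal{M}(\mathbb{W})$. $\mathcal{P}_d^N$ is the set of distributions of $(w(0),\dots,w(N-1))$ such that the $w(k)$ are independent and each $w(k)$ has distribution in $\mathcal{P}_d$. Controller: $V_d(x,\theta)=\max_{\mathbb{P}\in\mathcal{P}_d^N}\mathbb{E}_{\mathbb{P}}[J(x,\theta,\mathbf{w})]$, $V_d^0(x)=\min_{\theta\in\Pi(x)}V_d(x,\theta)$, and $\theta_d^0(x)$ is the set of minimizers. For each $d\in\mathcal{D}$, $\kappa_d:\mathcal{X}\to\mathbb{U}$ is a single-valued Borel measurable selection with $\kappa_d(x)\in\{v^0(0):(\mathbf{M}^0,\mathbf{v}^0)\in\theta_d^0(x)\}$. $\phi_d(k;x,\mathbf{w}_\infty)$ is the state at time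 $k$ of the closed-loop system $x^+=Ax+B\kappa_d(x)+Gw$ started at $x$ with disturbance sequence $\mathbf{w}_\infty=(w(0),w(1),\dots)\in\mathbb{W}^\infty$ (under the hypotheses $\mathcal{X}$ is invariant for this system, so this is well defined for $x\in\mathcal{X}$). Average performance, $k\ge 1$: $\mathcal{J}_k(x,d,\mathbb{P})=\mathbb{E}_{\mathbb{P}}\big[\frac1k\sum_{i=0}^{k-1}\ell(\phi_d(i;x,\mathbf{w}_\infty),\kappa_d(\phi_d(i;x,\mathbf{w}_\infty)))\big]$, defined for any distribution $\mathbb{P}$ of $\mathbf{w}_\infty$ (not necessarily related to $d$). $\mathcal{Q}$ is the set of distributions of $\mathbf{w}_\infty$ for which the $w(k)$ are independent and identically distributed with a common marginal $\mathbb{P}_0\in\mathcal{M}(\mathbb{W})$ satisfying $\mathbb{P}_0(|w|\le\varepsilon)>0$ for all $\varepsilon>0$. (In the conclusion, $\Sigma$ does not depend on $i$.) *)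

(* Defs.v *)
From HB Require Import structures.
From mathcomp Require Import all_boot all_order all_algebra.
From mathcomp Require Import finmap.
From mathcomp Require Import all_classical all_reals all_analysis.

Set Implicit Arguments.
Unset Strict Implicit.
Unset Printing Implicit Defensive.

Import Order.TTheory GRing.Theory Num.Theory.
Import numFieldNormedType.Exports.

Local Open Scope classical_set_scope.
Local Open Scope ring_scope.

Definition qform (R : realType) (n : nat) (S : 'M[R]_n) (x : 'cV[R]_n) : R :=
  (x^T *m S *m x) 0 0.

Definition psdmx (R : realType) (n : nat) (S : 'M[R]_n) : Prop :=
  S^T = S /\ forall x, 0 <= qform S x.

Definition pdmx (R : realType) (n : nat) (S : 'M[R]_n) : Prop :=
  S^T = S /\ forall x, x != 0 -> 0 < qform S x.

(* Junk value 0 when [S] is not positive semidefinite. *)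
Definition sqrtmx (R : realType) (n : nat) (S : 'M[R]_n) : 'M[R]_n :=
  xget 0 [set T | psdmx T /\ T *m T = S].

(* The library norm on matrices is the sup norm. *)
Definition norm2 (R : realType) (n : nat) (x : 'cV[R]_n) : R :=
  Num.sqrt (\sum_i x i 0 ^+ 2).

(* R^n with its Borel sigma-algebra. *)
Definition borelRn (R : realType) (n : nat) :=
  g_sigma_algebraType (@open 'cV[R]_n).

(* Families of vectors of R^q indexed by I, with the product sigma-algebra.
   It is used with I = 'I_N.+1 and with I = nat. *)
Definition cylinders (R : realType) (q : nat) (I : Type) :
    set (set (I -> 'cV[R]_q)) :=
  [set C | exists i (B : set (borelRn R q)),
     measurable B /\ C = [set w | B (w i)]].

Definition famRn (R : realType) (q : nat) (I : Type) :=
  g_sigma_algebraType (@cylinders R q I).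

Definition coord (R : realType) (q : nat) (I : Type) (i : I)
  (w : famRn R q I) : borelRn R q := w i.

Lemma measurable_coord (R : realType) (q : nat) (I : Type) (i : I) :
  measurable_fun [set: famRn R q I] (@coord R q I i).
Proof.
move=> _ B mB; rewrite setTI; apply: sub_sigma_algebra.
by exists i, B.
Qed.

HB.instance Definition _ (R : realType) (q : nat) (I : Type) (i : I) :=
  isMeasurableFun.Build _ _ (famRn R q I) (borelRn R q) (@coord R q I i)
    (@measurable_coord R q I i).

Section Distributions.
Context {R : realType} {q : nat}.

Definition marginal (I : Type) (P : probability (famRn R q I) R) (i : I) :
  probability (borelRn R q) R := distribution P (@coord R q I i).

Definition independent_coords (I : choiceType)
    (P : probability (famRn R q I) R) : Prop :=
  forall (J : {fset I}) (B : I -> set (borelRn R q)),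
    (forall i, measurable (B i)) ->
    P [set w | forall i, i \in J -> B i (w i)] =
    (\prod_(i <- J) marginal P i (B i))%E.

Definition zero_mean_on (W : set 'cV[R]_q) :
    set (probability (borelRn R q) R) :=
  [set P | (forall i, 'E_P[fun w : borelRn R q => (w : 'cV_q) i ord0] = 0)%E /\
     P W = 1%E].

Definition second_moment (P : probability (borelRn R q) R) : 'M[R]_q :=
  \matrix_(i, j) fine 'E_P[fun w : borelRn R q => (w *m w^T) i j]%E.

(* An ambiguity description is a pair d = (epsilon, hat Sigma). *)
Definition gelbrich_ball (d : R * 'M[R]_q) : set 'M[R]_q :=
  [set S | psdmx S /\
     \tr (d.2 + S - 2 *: sqrtmx (sqrtmx d.2 *m S *m sqrtmx d.2)) <= d.1 ^+ 2].

Definition ambiguity (W : set 'cV[R]_q) (d : R * 'M[R]_q) :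
    set (probability (borelRn R q) R) :=
  [set P | zero_mean_on W P /\ gelbrich_ball d (second_moment P)].

Definition admissible (W : set 'cV[R]_q) : set (R * 'M[R]_q) :=
  [set d | [/\ 0 <= d.1, psdmx d.2 &
     forall S, gelbrich_ball d S ->
       exists2 P, zero_mean_on W P & S = second_moment P]].

Definition ambiguity_product (W : set 'cV[R]_q) (d : R * 'M[R]_q)
    {I : choiceType} : set (probability (famRn R q I) R) :=
  [set P | independent_coords P /\ forall k, ambiguity W d (marginal P k)].

Definition iid_disturbances (W : set 'cV[R]_q) :
    set (probability (famRn R q nat) R) :=
  [set P | independent_coords P /\
     exists P0 : probability (borelRn R q) R,
       [/\ zero_mean_on W P0,
           forall e : R, 0 < e -> (0 < P0 [set w | (norm2 w <= e)%R])%E &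
           forall k (A : set (borelRn R q)),
             measurable A -> marginal P k A = P0 A]].

End Distributions.

Record mpc_data (R : realType) (n m q : nat) := MpcData {
  sysA : 'M[R]_n;
  sysB : 'M[R]_(n, m);
  sysG : 'M[R]_(n, q);
  inputs : set 'cV[R]_m;
  disturbances : set 'cV[R]_q;
  constraints : set ('cV[R]_n * 'cV[R]_m);
  terminal : set 'cV[R]_n;
  costQ : 'M[R]_n;
  costR : 'M[R]_m;
  costP : 'M[R]_n
}.

(* The horizon is N.+1.  A pair (M, v), with M given by its blocks M i j and v
   by its components v i; strict causality is imposed by [causal]. *)
Definition policy (R : realType) (m q N : nat) : Type :=
  (('I_N.+1 -> 'I_N.+1 -> 'M[R]_(m, q)) * ('I_N.+1 -> 'cV[R]_m))%type.

Definition causal (R : realType) (m q N : nat) : set (policy R m q N) :=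
  [set th | forall i j : 'I_N.+1, (i <= j)%N -> th.1 i j = 0].

Section Controller.
Context {R : realType} {n m q : nat} (N : nat) (D : mpc_data R n m q).
Implicit Types (x : 'cV[R]_n) (th : policy R m q N) (d : R * 'M[R]_q).

Definition stage_cost x (u : 'cV[R]_m) : R :=
  qform (costQ D) x + qform (costR D) u.

Definition pred_input th (w : 'I_N.+1 -> 'cV[R]_q) (i : 'I_N.+1) : 'cV[R]_m :=
  th.2 i + \sum_(j < N.+1 | (j < i)%N) th.1 i j *m w j.

(* Only used for k <= N.+1, so that [inord] is applied to indices below N.+1. *)
Fixpoint pred_state x th (w : 'I_N.+1 -> 'cV[R]_q) (k : nat) : 'cV[R]_n :=
  if k is j.+1 then
    sysA D *m pred_state x th w j + sysB D *m pred_input th w (inord j)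
      + sysG D *m w (inord j)
  else x.

Definition feasible_policies x : set (policy R m q N) :=
  [set th | causal th /\
     forall w : 'I_N.+1 -> 'cV[R]_q, (forall k, disturbances D (w k)) ->
       (forall k : 'I_N.+1,
          constraints D (pred_state x th w k, pred_input th w k)) /\
       terminal D (pred_state x th w N.+1)].

Definition feasible_states : set 'cV[R]_n :=
  [set x | feasible_policies x !=set0].

Definition horizon_cost x th (w : 'I_N.+1 -> 'cV[R]_q) : R :=
  \sum_(k < N.+1) stage_cost (pred_state x th w k) (pred_input th w k)
    + qform (costP D) (pred_state x th w N.+1).

Definition worst_cost d x th : \bar R :=
  ereal_sup [set ('E_P[horizon_cost x th])%E |
             P in ambiguity_product (I := 'I_N.+1) (disturbances D) d].

Definition optimal_policies d x : set (policy R m q N) :=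
  [set th | feasible_policies x th /\
     forall th', feasible_policies x th' ->
       (worst_cost d x th <= worst_cost d x th')%E].

(* [kap] is a function on the set of feasible states; its values elsewhere are
   irrelevant. *)
Definition control_law d (kap : 'cV[R]_n -> 'cV[R]_m) : Prop :=
  [/\ measurable_fun (feasible_states : set (borelRn R n))
        (kap : borelRn R n -> borelRn R m),
      (forall x, feasible_states x -> inputs D (kap x)) &
      forall x, feasible_states x ->
        exists2 th, optimal_policies d x th & kap x = th.2 ord0].

End Controller.

Section ClosedLoop.
Context {R : realType} {n m q : nat} (D : mpc_data R n m q).
Variable kap : 'cV[R]_n -> 'cV[R]_m.

Fixpoint closed_loop (x : 'cV[R]_n) (w : nat -> 'cV[R]_q) (k : nat) :
    'cV[R]_n :=
  if k is j.+1 then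
    let y := closed_loop x w j in
    sysA D *m y + sysB D *m kap y + sysG D *m w j
  else x.

(* The expectation is taken over the sequences with values in the disturbance
   set, on which the closed-loop trajectory is defined. *)
Definition average_cost (P : probability (famRn R q nat) R) (x : 'cV[R]_n)
    (k : nat) : \bar R :=
  (\int[P]_(w in [set w | forall i : nat, disturbances D (w i)])
     (k%:R^-1 * \sum_(i < k)
        stage_cost D (closed_loop x w i) (kap (closed_loop x w i)))%:E)%E.

End ClosedLoop.

Definition terminal_gain (R : realType) (n m q : nat) (D : mpc_data R n m q) :
    'M[R]_(m, n) :=
  - (invmx (costR D + (sysB D)^T *m costP D *m sysB D)
      *m (sysB D)^T *m costP D *m sysA D).

(* Main.v *)
Require Import Defs.
From HB Require Import structures.
From mathcomp Require Import all_boot all_order all_algebra.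
From mathcomp Require Import finmap fingroup perm sesquilinear spectral.
From mathcomp Require complex.
From mathcomp Require Import all_classical all_reals all_analysis.
From mathcomp Require Import measurable_realfun ring lra.

Set Implicit Arguments.
Unset Strict Implicit.
Unset Printing Implicit Defensive.

Import Order.TTheory GRing.Theory Num.Theory.
Import numFieldNormedType.Exports.

Local Open Scope classical_set_scope.
Local Open Scope ring_scope.

(** Let K be the terminal gain and S = R + B'PB.  The Riccati equation is a
    completion of squares: along one step of the system, the stage cost plus the
    next energy x'Px equals the energy plus the deviation (u - Kx)'S(u - Kx),
    plus the noise cost w'G'PGw and a cross term linear in w
    ([completion_of_squares], [qform_next]).  Taking expectations over a zero-mean
    disturbance that is independent of the present state removes the cross term
    ([energy_balance]).  Summed along the closed loop, this says that the average
    cost over k steps is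

      tr(G'PG Sigma) + (x'Px - E[x(k)'P x(k)]) / k + (1/k) sum of E[deviations].

    Since Q is positive definite the running cost dominates a fraction of the
    energy, so energies stay bounded as soon as the expected deviations are
    summable, and the limit follows ([average_limit]).

    Deviations vanish on the terminal set.  The same completion of squares along
    a predicted trajectory shows that the expected horizon cost of a policy is
    x'Px, plus its expected deviations, plus noise costs that no policy can
    influence ([expected_horizon_cost]).  On the terminal set linear feedback by K
    is feasible, has no deviation, and is thus optimal under every distribution
    at once; an optimal first input must equal Kx because S is definite
    ([terminal_optimal]).  Worst cases are finite, and they are taken over a
    nonempty set because the nominal covariance lies in its own Gelbrich ball
    ([ambiguity_product_ex]).  So the terminal set is invariant for the closed
    loop, and if it is the whole space then there is nothing left to show.

    If the feasible set is bounded, the expected deviation is at most a multiple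
    of the probability of being outside the terminal set, and this probability
    decays geometrically.  Indeed the optimal value decreases by the stage cost
    along the undisturbed system: the tail of an optimal policy, completed by K,
    is compared with the policy itself under the cyclically shifted disturbances,
    where the averaging over the first disturbance can only increase deviations,
    by Jensen's inequality ([nominal_tail_cost]).  The cost of the tail is convex
    in the first disturbance and bounded over possible ones, so the value still
    decreases by a fixed amount under all small disturbances, as long as the
    state is outside the terminal set and therefore away from the origin
    ([value_descent], [outside_cost]).  Small disturbances have positive
    probability; a fixed number of them in a row leads to the terminal set from
    any feasible state ([hitting_probability], [uniform_hitting]).

    Two points of measure theory support this.  The feasible set is closed, as
    feasible policies are uniformly bounded and constraints pass to limits along
    ultrafilters ([feasible_states_closed]); the control law then extends to a
    Borel function on the whole space.  Independence is used through resampling: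
    replacing one coordinate of an independent family by a fresh variable with
    the same law does not change the law of the family ([resampledE]).  This
    yields Fubini's theorem in one coordinate, the Markov property of the closed
    loop ([expectation_trajectory]), and, applied to all coordinates of a
    deterministic family in turn, the existence of independent families with a
    given common law ([iid_ex]). *)

(** * Quadratic forms and matrix square roots *)

Section QuadraticForms.
Context {R : realType}.
Implicit Types n p : nat.

Lemma qform0 n (S : 'M[R]_n) : qform S 0 = 0.
Proof. by rewrite /qform mulmx0 mxE. Qed.

Lemma qformN n (S : 'M[R]_n) x : qform S (- x) = qform S x.
Proof. by rewrite /qform [(- x)^T]linearN /= !mulNmx mulmxN opprK. Qed.

Lemma qformM n p (S : 'M[R]_n) (L : 'M[R]_(n, p)) x :
  qform S (L *m x) = qform (L^T *m S *m L) x.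
Proof. by rewrite /qform trmx_mul !mulmxA. Qed.

Lemma qform_add n (S1 S2 : 'M[R]_n) x :
  qform (S1 + S2) x = qform S1 x + qform S2 x.
Proof. by rewrite /qform mulmxDr mulmxDl mxE. Qed.

Lemma qformD n (S : 'M[R]_n) (x y : 'cV[R]_n) : S^T = S ->
  qform S (x + y) = qform S x + 2 * (x^T *m S *m y) 0 0 + qform S y.
Proof.
move=> symS; rewrite /qform.
have -> : (x + y)^T *m S *m (x + y) = x^T *m S *m x + x^T *m S *m y
    + y^T *m S *m x + y^T *m S *m y.
  by rewrite [(x + y)^T]linearD /= !mulmxDl !mulmxDr !addrA (addrAC (_ + _) _ (_ *m y)).
have -> : y^T *m S *m x = (x^T *m S *m y)^T.
  by rewrite !trmx_mul trmxK symS mulmxA.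
rewrite !mxE; ring.
Qed.

Lemma qformZ n (S : 'M[R]_n) a x : qform S (a *: x) = a ^+ 2 * qform S x.
Proof.
by rewrite /qform [(a *: x)^T]linearZ /= -!scalemxAl -!scalemxAr !mxE; ring.
Qed.

Lemma qform_sum n (S : 'M[R]_n) (x : 'cV[R]_n) :
  qform S x = \sum_j \sum_i x i 0 * S i j * x j 0.
Proof.
rewrite /qform mxE; apply: eq_bigr => j _; rewrite mxE mulr_suml.
by apply: eq_bigr => i _; rewrite mxE.
Qed.

Lemma qform1 n (x : 'cV[R]_n) : qform 1%:M x = \sum_i x i 0 ^+ 2.
Proof.
rewrite /qform mulmx1 mxE; apply: eq_bigr => i _.
by rewrite mxE expr2.
Qed.

Lemma qform_sqr n (T : 'M[R]_n) x : T^T = T ->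
  qform (T *m T) x = \sum_i (T *m x) i 0 ^+ 2.
Proof.
by move=> symT; rewrite -qform1 qformM symT mulmx1.
Qed.

Lemma pdmx_psd n (S : 'M[R]_n) : pdmx S -> psdmx S.
Proof.
move=> [symS S0]; split=> // x.
by have [->|/S0/ltW//] := eqVneq x 0; rewrite qform0.
Qed.

Lemma pdmx_eq0 n (S : 'M[R]_n) x : pdmx S -> qform S x <= 0 -> x = 0.
Proof. by move=> [_ S0] Sx; apply/eqP/negP => /negP/S0; rewrite ltNge Sx. Qed.

Lemma qform_convex n (S : 'M[R]_n) (x y : 'cV[R]_n) (t : R) : psdmx S ->
  0 <= t <= 1 ->
  qform S ((1 - t) *: x + t *: y) <= (1 - t) * qform S x + t * qform S y.
Proof.
move=> [symS S0] t01; rewrite qformD// !qformZ.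
have := S0 (x - y); rewrite qformD// qformN.
rewrite -!scalemxAr [((1 - t) *: x)^T]linearZ /= -!scalemxAl !mulmxN !mxE => H.
set a := qform S x in H *; set b := qform S y in H *.
set c := (\sum_j _ * y j 0) in H *.
have -> : (1 - t) * a + t * b = (1 - t) ^+ 2 * a + 2 * (t * ((1 - t) * c))
   + t ^+ 2 * b + t * (1 - t) * (a + 2 * - c + b) by ring.
by rewrite lerDl mulr_ge0// mulr_ge0//; case/andP: t01; lra.
Qed.

(** A positive semidefinite form vanishing at [y] has [y] in its kernel, as
    otherwise its values along a line through [y] would change sign. *)
Lemma psdmx_ker n (S : 'M[R]_n) y : psdmx S -> qform S y = 0 -> S *m y = 0.
Proof.
move=> [symS S0] Sy0; pose z := S *m y.
have zz : (y^T *m S *m z) 0 0 = \sum_i z i 0 ^+ 2.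
  rewrite -qform1 /qform mulmx1 /z trmx_mul symS; congr (_ 0 0); by rewrite mulmxA.
pose a := \sum_i z i 0 ^+ 2; pose b := qform S z.
have a0 : 0 <= a by apply: sumr_ge0 => i _; exact: sqr_ge0.
have b0 : 0 <= b by exact: S0.
have H t : 0 <= 2 * t * a + t ^+ 2 * b.
  have := S0 (y + t *: z); rewrite qformD// Sy0 qformZ -scalemxAr mxE zz -/a -/b.
  by rewrite add0r mulrA.
have {}a0 : a = 0.
  apply/eqP; rewrite eq_le a0 andbT leNgt; apply/negP => agt0.
  have b1 : 0 < b + 1 by lra.
  (* This step decreases the form, whose curvature along [z] is b < b + 1. *)
  have := H (- a / (b + 1)).
  have -> : 2 * (- a / (b + 1)) * a + (- a / (b + 1)) ^+ 2 * b =
    - (a ^+ 2 / (b + 1)) * (1 + 1 / (b + 1)) by field; rewrite gt_eqF.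
  rewrite mulNr oppr_ge0 leNgt => /negP; apply.
  apply: mulr_gt0; first by rewrite divr_gt0// exprn_gt0.
  by rewrite addr_gt0// divr_gt0.
apply/matrixP => i j; rewrite ord1 [RHS]mxE.
have := psumr_eq0P (F := fun i => z i 0 ^+ 2) (fun i _ => sqr_ge0 _) a0.
by move=> /(_ i isT) /eqP; rewrite sqrf_eq0 => /eqP.
Qed.

Lemma col_qform0 n (S : 'M[R]_n) (E : 'M[R]_n) : psdmx S ->
  (forall i, qform S (col i E) = 0) -> S *m E = 0.
Proof.
move=> psdS SE; apply/matrixP => i j; rewrite [RHS]mxE.
have /matrixP/(_ i 0) := psdmx_ker psdS (SE j); rewrite [X in _ = X]mxE.
by move=> <-; rewrite !mxE; apply: eq_bigr => k _; rewrite !mxE.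
Qed.

Lemma qform_col n (S : 'M[R]_n) (E : 'M[R]_n) i :
  qform S (col i E) = (E^T *m S *m E) i i.
Proof.
rewrite /qform !mxE; apply: eq_bigr => j _; rewrite !mxE; congr (_ * _).
by apply: eq_bigr => k _; rewrite !mxE.
Qed.

(** With E = T - S one has E(T + S) + (T + S)E = 0, so that the positive
    semidefinite matrix E(T + S)E has trace zero, and TE = SE = 0. *)
Lemma psdmx_sqr_inj n (S T : 'M[R]_n) : psdmx S -> psdmx T ->
  T *m T = S *m S -> T = S.
Proof.
move=> psdS psdT TS.
have [symS S0] := psdS; have [symT T0] := psdT.
pose E := T - S; have symE : E^T = E by rewrite /E linearB /= symS symT.
have EF : E *m (T + S) + (T + S) *m E = 0.
  rewrite /E mulmxBl !mulmxDr !mulmxDl !mulmxN TS.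
  by apply/matrixP => i j; rewrite !mxE; ring.
have tr0 : \tr (E *m (T + S) *m E) = 0.
  have : \tr ((E *m (T + S) + (T + S) *m E) *m E) = 0 by rewrite EF mul0mx mxtrace0.
  rewrite mulmxDl mxtraceD.
  rewrite [X in _ + X]mxtrace_mulC mulmxA => /eqP.
  by rewrite -mulr2n mulrn_eq0/= => /eqP.
have H i : qform T (col i E) = 0 /\ qform S (col i E) = 0.
  have : qform (T + S) (col i E) = 0.
    rewrite qform_col symE; apply: (psumr_eq0P _ tr0) => // j _.
    by rewrite -{1}symE -qform_col qform_add addr_ge0.
  by rewrite qform_add => /eqP; rewrite paddr_eq0// => /andP[/eqP-> /eqP->].
have TE := col_qform0 psdT (fun i => (H i).1).
have SE := col_qform0 psdS (fun i => (H i).2).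
have EE : E *m E = 0 by rewrite {1}/E mulmxBl TE SE subrr.
have E0 i : col i E = 0.
  have /(psdmx_ker (S := 1%:M)) : qform 1%:M (col i E) = 0.
    by rewrite qform_col mulmx1 symE EE mxE.
  rewrite mul1mx; apply; split; first by rewrite trmx1.
  by move=> x; rewrite qform1 sumr_ge0// => j _; exact: sqr_ge0.
apply/eqP; rewrite -subr_eq0 -/E; apply/eqP/matrixP => i j.
by have /matrixP/(_ i 0) := E0 j; rewrite !mxE.
Qed.

End QuadraticForms.

Section SquareRoot.
Import complex.
Context {R : realType}.

Lemma trmx_horner n (S : 'M[R]_n.+1) (p : {poly R}) : S^T = S ->
  (horner_mx S p)^T = horner_mx S p.
Proof.
move=> symS; elim/poly_ind: p => [|p c IH]; first by rewrite rmorph0 trmx0.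
rewrite rmorphD rmorphM /= horner_mx_X horner_mx_C linearD /= tr_scalar_mx.
rewrite -[X in X^T]/(_ *m _) trmx_mul IH symS; congr (_ + _).
rewrite -[S *m _]/(S * _) -{1}(horner_mx_X S) -rmorphM mulrC rmorphM /=.
by rewrite horner_mx_X.
Qed.

Lemma interpolation m (d : 'I_m -> R) (g : R -> R) :
  exists p : {poly R}, forall i, p.[d i] = g (d i).
Proof.
(* Lagrange interpolation at the distinct values, as [d] may repeat some. *)
pose s := undup [seq d i | i <- enum 'I_m].
pose x := nth 0 s.
have inj : {in [pred i | (i < size s)%N] &, injective x}.
  by move=> i j /= si sj xij; apply/eqP; rewrite -(nth_uniq 0 si sj) ?undup_uniq//; apply/eqP.
exists (\sum_(k < size s) (g (x k))%:P *
  \prod_(j < size s | j != k) (((x k - x j)^-1)%:P * ('X - (x j)%:P))) => i.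
have dis : d i \in s by rewrite mem_undup; apply/mapP; exists i; rewrite ?mem_enum.
have lti : (index (d i) s < size s)%N by rewrite index_mem.
pose k0 := Ordinal lti.
have xk0 : x k0 = d i by exact: nth_index.
rewrite horner_sum (bigD1 k0)//= [X in _ + X]big1 ?addr0.
  rewrite hornerM hornerC xk0 horner_prod big1 ?mulr1// => j jk.
  rewrite hornerM hornerC hornerXsubC mulVf// subr_eq0 -xk0.
  by apply: contra jk => /eqP/inj => /(_ lti (ltn_ord j)) jk; apply/eqP/val_inj.
move=> k kk0; rewrite hornerM horner_prod (bigD1 k0) 1?eq_sym//=.
by rewrite hornerM hornerXsubC xk0 subrr mulr0 mul0r mulr0.
Qed.

(** Over the complex numbers S is unitarily diagonalizable with nonnegative
    eigenvalues.  A real polynomial p interpolating the fourth root at these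
    gives a symmetric p(S) with p(S)^4 = S; its square is the wanted root. *)
Lemma psdmx_sqrt_ex n (S : 'M[R]_n) : psdmx S ->
  exists T, psdmx T /\ T *m T = S.
Proof.
case: n S => [|n] S psdS.
  by exists S; split=> //; rewrite !(flatmx0 S) mul0mx.
have [symS S0] := psdS.
pose f := [the {rmorphism R -> R[i]} of real_complex R].
pose SC := map_mx f S.
have SCreal : SC \is a realmx.
  by apply/mxOverP => i j; rewrite mxE complex_real.
have SCsym : SC \is symmetricmx.
  by apply/is_hermitianmxP; rewrite expr0 scale1r map_mx_id// map_trmx symS.
have SCherm := realsym_hermsym SCsym SCreal.
have /orthomx_spectralP SCE := symmetric_normalmx SCsym SCreal.
have spreal := hermitian_spectral_diag_real SCherm.
set V := spectralmx SC in SCE; set sp := spectral_diag SC in SCE spreal.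
have Vu : V \in unitmx by exact: spectral_unit.
pose d i := Re (sp 0 i).
have spE i : sp 0 i = f (d i).
  by rewrite /f /= /d RRe_real//; have /mxOverP := spreal; apply.
have dge0 i : 0 <= d i.
  have : eigenvalue SC (sp 0 i).
    apply/eigenvalueP; exists (row i V).
      rewrite [X in _ *m X]SCE -row_mul !mulmxA mulmxV// mul1mx mul_diag_mx.
      by apply/rowP => j; rewrite !mxE.
    apply/negP => /eqP /(congr1 (fun M => (M *m invmx V) 0 i)).
    by rewrite -row_mul mulmxV// mul0mx !mxE eqxx => /eqP; rewrite oner_eq0.
  rewrite spE (eigenvalue_map f) => /eigenvalueP[v vS v0].
  have vSv : (v *m S *m v^T) 0 0 = d i * \sum_j v 0 j ^+ 2.
    rewrite vS -scalemxAl !mxE; congr (_ * _); apply: eq_bigr => j _.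
    by rewrite mxE expr2.
  have vpos : 0 < \sum_j v 0 j ^+ 2.
    rewrite lt_neqAle sumr_ge0 ?andbT; last by move=> j _; exact: sqr_ge0.
    rewrite eq_sym; apply: contra v0 => /eqP v0; apply/eqP/rowP => j.
    have := psumr_eq0P (fun j _ => sqr_ge0 (v 0 j)) v0.
    by move=> /(_ j isT)/eqP; rewrite sqrf_eq0 mxE => /eqP.
  have := S0 v^T; rewrite /qform trmxK vSv.
  by rewrite pmulr_lge0.
have [p pE] := interpolation d (fun t => Num.sqrt (Num.sqrt t)).
pose H := horner_mx S p.
have symH : H^T = H by exact: trmx_horner.
have H4 : (H *m H) *m (H *m H) = S.
  have -> : (H *m H) *m (H *m H) = horner_mx S (p ^+ 4).
    by rewrite rmorphXn /= -/H !exprS expr0 mulr1 -![_ *m _]/(_ * _) !mulrA.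
  apply: (map_mx_inj (f := f)); rewrite map_horner_mx -/SC.
  rewrite [in LHS]SCE horner_mx_uconjC// horner_mx_diag [RHS]SCE.
  congr (_ *m diag_mx _ *m _); apply/rowP => i; rewrite mxE spE.
  rewrite horner_map /=; congr (f _).
  rewrite horner_exp pE (_ : 4 = 2 * 2)%N// exprM !sqr_sqrtr ?sqrtr_ge0//.
exists (H *m H); split=> //; split.
  by rewrite trmx_mul symH.
by move=> x; rewrite qform_sqr// sumr_ge0// => i _; exact: sqr_ge0.
Qed.

Lemma sqrtmxP n (S : 'M[R]_n) : psdmx S ->
  psdmx (sqrtmx S) /\ sqrtmx S *m sqrtmx S = S.
Proof. by move=> /psdmx_sqrt_ex; exact: xgetPex. Qed.

End SquareRoot.

Section GelbrichCenter.
Context {R : realType} {q : nat}.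

(** The nominal covariance is at Gelbrich distance zero from itself, as the
    root of H S H, where H is the root of S, is S.  So an admissible ambiguity
    set contains a distribution, and worst cases are not suprema of nothing. *)
Lemma gelbrich_ball_center (d : R * 'M[R]_q) : 0 <= d.1 -> psdmx d.2 ->
  gelbrich_ball d d.2.
Proof.
move=> d1 psd2; split=> //.
have [psdH HH] := sqrtmxP psd2; set H := sqrtmx d.2 in psdH HH *.
have -> : H *m d.2 *m H = d.2 *m d.2 by rewrite -{1 2 3}HH !mulmxA.
have psdSS : psdmx (d.2 *m d.2).
  have [sym2 _] := psd2; split; first by rewrite trmx_mul sym2.
  by move=> x; rewrite qform_sqr// sumr_ge0// => i _; exact: sqr_ge0.
have [psdT TT] := sqrtmxP psdSS.
rewrite (psdmx_sqr_inj psd2 psdT TT) scaler_nat mulr2n subrr mxtrace0.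
exact: sqr_ge0.
Qed.

End GelbrichCenter.

Section Norms.
Context {R : realType}.

Lemma mx_norm_entry m n (M : 'M[R]_(m, n)) i j : `|M i j| <= `|M|.
Proof.
rewrite [leRHS]/Num.norm /= mx_normrE; exact: (le_bigmax _ _ (i, j)).
Qed.

Lemma mx_norm_le m n (M : 'M[R]_(m, n)) c : 0 <= c ->
  (forall i j, `|M i j| <= c) -> `|M| <= c.
Proof.
by move=> c0 H; rewrite [leLHS]/Num.norm /= mx_normrE; apply: bigmax_le.
Qed.

Lemma mulmx_norm_le m n p (M : 'M[R]_(m, n)) (x : 'M[R]_(n, p)) :
  `|M *m x| <= n%:R * `|M| * `|x|.
Proof.
apply: mx_norm_le => [|i j]; first by rewrite !mulr_ge0.
rewrite mxE (le_trans (ler_norm_sum _ _ _))//.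
rewrite (le_trans (ler_sum _ (G := fun=> `|M| * `|x|) _))//.
  by move=> k _; rewrite normrM ler_pM// mx_norm_entry.
by rewrite sumr_const card_ord -mulrA mulr_natl.
Qed.

Lemma qform_le_norm n (S : 'M[R]_n) x :
  `|qform S x| <= n%:R * (n%:R * `|S|) * `|x| ^+ 2.
Proof.
rewrite /qform -mulmxA (le_trans (mx_norm_entry _ _ _))//.
rewrite (le_trans (mulmx_norm_le _ _))//.
have -> : `|x^T| = `|x|.
  apply/eqP; rewrite eq_le; apply/andP; split; apply: mx_norm_le => // i j.
    by rewrite mxE mx_norm_entry.
  by rewrite -[x]trmxK [x^T^T i j]mxE trmxK mx_norm_entry.
rewrite -!mulrA ler_wpM2l// expr2.
rewrite mulrCA [leRHS]mulrCA.
by rewrite [leRHS]mulrA [leRHS]mulrC -mulrA ler_wpM2l// mulrC (le_trans (mulmx_norm_le _ _))// mulrA.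
Qed.

(** Writing S = H^2 with H symmetric, S is definite exactly when H is
    invertible, and then |x| <= C |H x|. *)
Lemma pdmx_lower n (S : 'M[R]_n) : pdmx S ->
  exists2 c : R, 0 < c & forall x, c * `|x| ^+ 2 <= qform S x.
Proof.
move=> pdS; have [psdH HH] := sqrtmxP (pdmx_psd pdS).
set H := sqrtmx S in psdH HH; have [symH _] := psdH.
have Hu : H \in unitmx.
  rewrite -unitmx_tr -row_free_unit -kermx_eq0; apply/eqP/row_matrixP => i.
  set v := row i _.
  have vH : v *m H^T = 0 by apply/sub_kermxP; exact: row_sub.
  have : qform S v^T <= 0.
    by rewrite -HH /qform trmxK -mulmxA -mulmxA mulmxA -[X in v *m X *m _]symH vH mul0mx mxE.
  move/(pdmx_eq0 pdS) => /(congr1 trmx); rewrite trmxK => ->.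
  by rewrite trmx0 row0.
pose C := n%:R * `|invmx H| + 1.
have C0 : 0 < C by rewrite ltr_wpDl// mulr_ge0.
exists (C ^+ 2)^-1; first by rewrite invr_gt0 exprn_gt0.
move=> x; rewrite ler_pdivrMl ?exprn_gt0//.
have xle : `|x| <= C * `|H *m x|.
  rewrite -{1}[x](mulKmx Hu) (le_trans (mulmx_norm_le _ _))//.
  by rewrite ler_wpM2r// lerDl.
have H2 : `|H *m x| ^+ 2 <= qform S x.
  rewrite -HH qform_sqr//.
  have s0 : 0 <= \sum_i (H *m x) i 0 ^+ 2 by apply: sumr_ge0 => i _; exact: sqr_ge0.
  rewrite -[leRHS]sqr_sqrtr// ler_sqr ?nnegrE ?sqrtr_ge0//.
  apply: mx_norm_le => [|i j]; first exact: sqrtr_ge0.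
  rewrite ord1 -sqrtr_sqr ler_wsqrtr// (bigD1 i)//= lerDl.
  by apply: sumr_ge0 => k _; exact: sqr_ge0.
rewrite (le_trans (y := (C * `|H *m x|) ^+ 2))//.
  by rewrite ler_sqr ?nnegrE// mulr_ge0// ltW.
by rewrite exprMn ler_wpM2l// sqr_ge0.
Qed.

End Norms.

(** * Borel functions with vector values *)

Section BorelVectors.
Context {R : realType}.

Lemma open_borel n (U : set 'cV[R]_n) : open U ->
  measurable (U : set (borelRn R n)).
Proof. by move=> oU; exact: sub_sigma_algebra. Qed.

Lemma closed_borel n (F : set 'cV[R]_n) : closed F ->
  measurable (F : set (borelRn R n)).
Proof.
by move=> cF; rewrite -[F]setCK; apply: measurableC; apply: open_borel;
   exact: closed_openC.
Qed.

Lemma continuous_borel n (f : 'cV[R]_n -> R) : continuous f ->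
  measurable_fun setT (f : borelRn R n -> R).
Proof.
move=> cf; apply: (measurability _ (RGenOpens.measurableE R)) => _ [_ [a [b ->] <-]].
rewrite setTI; apply: open_borel; move/continuousP: cf; apply.
exact: interval_open.
Qed.

Lemma measurable_entry n (i : 'I_n) :
  measurable_fun setT (fun x : borelRn R n => (x : 'cV[R]_n) i 0).
Proof. by apply: continuous_borel; exact: coord_continuous. Qed.

(** An open set is the union of the countably many rational boxes that it
    contains, so a vector function is Borel as soon as its entries are. *)
Lemma measurable_vec d (T : measurableType d) n (D : set T) (f : T -> borelRn R n) :
  measurable D ->
  (forall i, measurable_fun D (fun t => (f t : 'cV[R]_n) i 0)) ->
  measurable_fun D f.
Proof.
move=> mD mf.
apply: (@measurability _ _ _ (borelRn R n) _ _ (@open 'cV[R]_n)) => // _ [U oU <-].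
pose box (p : 'cV[rat]_n * nat) : set 'cV[R]_n :=
  [set y | forall i, `|y i 0 - ratr (p.1 i 0)| < p.2.+1%:R^-1].
pose F k := if @choice.unpickle ('cV[rat]_n * nat)%type k is Some p then
   if `[< box p `<=` U >] then box p else set0 else set0.
have -> : U = \bigcup_k F k.
  apply/seteqP; split => [y Uy|y [k _]]; last first.
    rewrite /F; case: (@choice.unpickle ('cV[rat]_n * nat)%type k) => [p|]//.
    by case: ifPn => [/asboolP pU /pU|].
  have /nbhs_ballP[e /= e0 eU] : nbhs y U by exact: open_nbhs_nbhs.
  have [k ke] : exists k, k.+1%:R^-1 < e / 2.
    have e20 : 0 < e / 2 by rewrite divr_gt0.
    exists (Num.trunc (e / 2)^-1).
    by rewrite invf_plt ?posrE// ?ltr0n// truncnS_gt// invr_ge0 ltW.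
  have [a ay] : exists a : 'cV[rat]_n, forall i, `|y i 0 - ratr (a i 0)| < k.+1%:R^-1.
    have H i : exists a : rat, `|y i 0 - ratr a| < k.+1%:R^-1.
      have [|a] := @rat_in_itvoo R (y i 0 - k.+1%:R^-1) (y i 0 + k.+1%:R^-1).
        by rewrite ltrD2l gtrN// ltr0n.
      rewrite in_itv /= => /andP[a1 a2]; exists a.
      by rewrite ltr_distlC a1.
    have [g gP] := choice H.
    by exists (\col_i g i) => i; rewrite mxE.
  exists (choice.pickle (a, k)) => //; rewrite /F choice.pickleK.
  case: ifPn => [_ i|/asboolP]; first exact: ay.
  case; move=> z zb; apply: eU; split => // i j; rewrite ord1.
  rewrite /ball /= /ball_ /=.
  rewrite (le_lt_trans (ler_distD (ratr (a i 0)) _ _))// (splitr e) ltrD//.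
    exact: lt_trans (ay i) ke.
  by rewrite distrC; exact: lt_trans (zb i) ke.
rewrite preimage_bigcup setI_bigcupr; apply: bigcupT_measurable => k.
rewrite /F; case: (@choice.unpickle ('cV[rat]_n * nat)%type k) => [p|]; last by rewrite preimage_set0 setI0.
case: ifPn => _; last by rewrite preimage_set0 setI0.
have -> : D `&` f @^-1` box p = D `&` \bigcap_(i in [set: 'I_n])
   (D `&` (fun t => (f t : 'cV[R]_n) i 0) @^-1` ball (ratr (p.1 i 0) : R) (p.2.+1%:R^-1)).
  apply/seteqP; split => t [Dt H]; split=> //.
    by move=> i _; split=> //=; rewrite /ball /= /ball_ /= distrC; exact: H.
  move=> i; have [_ /=] := H i I.
  by rewrite /ball /= /ball_ /= distrC.
apply: measurableI => //; apply: fin_bigcap_measurable => // i _.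
apply: mf => //; exact: measurable_ball.
Qed.

Lemma measurable_vec_entry d (T : measurableType d) n (D : set T)
    (f : T -> borelRn R n) i :
  measurable_fun D f -> measurable_fun D (fun t => (f t : 'cV[R]_n) i 0).
Proof. by move=> mf; exact: (measurableT_comp (measurable_entry i) mf). Qed.

Lemma measurable_vecD d (T : measurableType d) n (f g : T -> borelRn R n) :
  measurable_fun setT f -> measurable_fun setT g ->
  measurable_fun setT (fun t => (f t : 'cV[R]_n) + g t : borelRn R n).
Proof.
move=> mf mg; apply: measurable_vec => // i.
rewrite (_ : (fun _ => _) = fun t => (f t : 'cV[R]_n) i 0 + (g t : 'cV[R]_n) i 0).
  by apply: measurable_funD; exact: measurable_vec_entry.
by apply/funext => t; rewrite mxE.
Qed.

Lemma measurable_vecM d (T : measurableType d) n p (M : 'M[R]_(p, n))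
    (f : T -> borelRn R n) :
  measurable_fun setT f ->
  measurable_fun setT (fun t => M *m (f t : 'cV[R]_n) : borelRn R p).
Proof.
move=> mf; apply: measurable_vec => // i.
rewrite (_ : (fun _ => _) = fun t => \sum_j M i j * (f t : 'cV[R]_n) j 0).
  apply: measurable_sum => j.
  by apply: measurable_funM => //; exact: measurable_vec_entry.
by apply/funext => t; rewrite mxE.
Qed.

Lemma measurable_form d (T : measurableType d) n p (L : 'M[R]_(n, p))
    (f : T -> borelRn R n) (g : T -> borelRn R p) :
  measurable_fun setT f -> measurable_fun setT g ->
  measurable_fun setT (fun t => (((f t : 'cV[R]_n)^T *m L *m g t) 0 0 : R)).
Proof.
move=> mf mg.
rewrite (_ : (fun _ => _) =
  fun t => \sum_j (\sum_i (f t : 'cV[R]_n) i 0 * L i j) * (g t : 'cV[R]_p) j 0).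
  apply: measurable_sum => j; apply: measurable_funM; last exact: measurable_vec_entry.
  apply: measurable_sum => i.
  by apply: measurable_funM => //; exact: measurable_vec_entry.
apply/funext => t; rewrite mxE; apply: eq_bigr => j _; rewrite mxE; congr (_ * _).
by apply: eq_bigr => i _; rewrite mxE.
Qed.

Lemma measurable_qform d (T : measurableType d) n (S : 'M[R]_n)
    (f : T -> borelRn R n) :
  measurable_fun setT f -> measurable_fun setT (fun t => qform S (f t)).
Proof. by move=> mf; exact: measurable_form. Qed.

End BorelVectors.

(** * Families of independent vectors *)

Section Families.
Context {R : realType} {q : nat}.

Lemma measurable_fam d (T : measurableType d) I (f : T -> famRn R q I) :
  (forall i, measurable_fun setT (fun t => f t i : borelRn R q)) ->
  measurable_fun setT f.
Proof.
move=> mf.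
apply: (@measurability _ _ _ (famRn R q I) _ _ (@cylinders R q I)) => //.
move=> _ [_ [i [B [mB ->]]] <-].
rewrite setTI; have := mf i measurableT B mB.
by rewrite setTI.
Qed.

Section Rectangles.
Context {I : choiceType}.

Definition rect (J : {fset I}) (B : I -> set (borelRn R q)) : set (famRn R q I) :=
  [set w | forall i, i \in J -> B i (w i)].

Lemma measurable_rect J B : (forall i, measurable (B i)) -> measurable (rect J B).
Proof.
move=> mB.
have -> : rect J B = \bigcap_(i in [set` J]) (@Defs.coord R q I i @^-1` B i).
  by apply/seteqP; split=> w /= H i iJ; exact: H.
apply: fin_bigcap_measurable => // i _.
rewrite -[X in measurable X]setTI; exact: measurable_coord.
Qed.

(** Rectangles are stable under intersection and generate the product
    sigma-algebra. *)
Lemma eq_rect_measure (P1 P2 : {finite_measure set (famRn R q I) -> \bar R}) :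
  (forall J B, (forall i, measurable (B i)) -> P1 (rect J B) = P2 (rect J B)) ->
  forall A, measurable A -> P1 A = P2 A.
Proof.
move=> P12 A mA.
pose rects := [set C | exists J B, (forall i, measurable (B i)) /\ C = rect J B].
apply: (@measure_unique _ _ _ rects (fun=> setT)) => //.
- apply/seteqP; split.
    apply: smallest_sub; first exact: smallest_sigma_algebra.
    move=> _ [i [B [mB ->]]]; apply: sub_sigma_algebra.
    exists [fset i]%fset, (fun=> B); split=> //.
    apply/seteqP; split=> w /=; first by move=> Bw j /[!inE] /eqP ->.
    by apply; rewrite inE.
  apply: smallest_sub; first exact: sigma_algebra_measurable.
  by move=> _ [J [B [mB ->]]]; exact: measurable_rect.
- move=> _ _ [J [B [mB ->]]] [K [C [mC ->]]].
  exists (J `|` K)%fset, (fun i => (if i \in J then B i else setT) `&`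
     (if i \in K then C i else setT)); split.
    by move=> i; apply: measurableI; case: ifP.
  apply/seteqP; split=> w /=.
    move=> [HB HC] i; rewrite inE => _.
    by split; case: ifPn => // ?; [exact: HB|exact: HC].
  move=> H; split=> i iJ.
    by have := H i; rewrite inE iJ /= => /(_ isT)[].
  by have := H i; rewrite inE iJ orbT /= => /(_ isT)[_].
- move=> k; exists fset0, (fun=> setT); split=> //.
  by apply/seteqP; split.
- by apply/seteqP; split=> // w _; exists 0.
- by move=> B [J [C [mC ->]]]; exact: P12.
- by move=> k; rewrite -ge0_fin_numE ?fin_num_measure.
Qed.

End Rectangles.

Section Resampling.
Context {I : choiceType}.

(** Drawing the new value of coordinate [k] independently of the family turns
    independence into Fubini's theorem. *)
Definition resample (k : I) (p : famRn R q I * borelRn R q) : famRn R q I :=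
  fun i => if i == k then p.2 else p.1 i.

Lemma measurable_resample k : measurable_fun setT (resample k).
Proof.
apply: measurable_fam => i; rewrite /resample; case: (i == k).
  exact: measurable_snd.
exact: (measurableT_comp (measurable_coord i) measurable_fst).
Qed.

HB.instance Definition _ k := isMeasurableFun.Build _ _
  (famRn R q I * borelRn R q)%type (famRn R q I) (resample k)
  (measurable_resample k).

Definition resampled (P : probability (famRn R q I) R)
    (rho : probability (borelRn R q) R) k : probability (famRn R q I) R :=
  distribution (P \x rho)%E (resample k).

Lemma resampled_rect P rho k J B : independent_coords P ->
  (forall i, measurable (B i)) ->
  resampled P rho k (rect J B) =
  ((\prod_(i <- (J `\ k)%fset) marginal P i (B i)) *
    (if k \in J then rho (B k) else 1))%E.
Proof.
move=> indP mB.
pose C := if k \in J then B k else setT.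
have -> : resampled P rho k (rect J B) = (P \x rho)%E (rect (J `\ k)%fset B `*` C).
  rewrite [LHS]/(pushforward _ _ _) /pushforward; congr (fun S => (P \x rho)%E S).
  apply/seteqP; split=> -[w w0] /=; rewrite /rect /resample /C /=.
    move=> H; split=> [i|].
      by rewrite !inE => /andP[ik iJ]; have := H i iJ; rewrite (negPf ik).
    by case: ifPn => // kJ; have := H k kJ; rewrite eqxx.
  move=> [H Hk] i iJ; case: ifPn => [/eqP ik|ik]; first by rewrite ik in iJ *; rewrite iJ in Hk.
  by apply: H; rewrite !inE ik.
have mC : measurable C by rewrite /C; case: ifP.
rewrite product_measure1E//; last exact: measurable_rect.
rewrite [X in (X * _)%E](indP _ _ mB); congr (_ * _)%E; rewrite /C; case: ifP => // _.
exact: probability_setT.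
Qed.

Lemma marginal_rect (P : probability (famRn R q I) R) i (A : set (borelRn R q)) :
  marginal P i A = P (rect [fset i]%fset (fun=> A)).
Proof.
rewrite /marginal /distribution /pushforward; congr (P _).
apply/seteqP; split=> w /=; first by move=> Aw j; rewrite inE => /eqP ->.
by apply; rewrite inE.
Qed.

Lemma resampled_marginal P rho k i A : independent_coords P -> measurable A ->
  marginal (resampled P rho k) i A = if i == k then rho A else marginal P i A.
Proof.
move=> indP mA; rewrite marginal_rect resampled_rect// inE eq_sym.
case: eqP => [->|/eqP ki].
  by rewrite (_ : _ `\ _ = fset0)%fset ?big_seq_fset0 ?mul1e//; apply/fsetP => j; rewrite !inE andNb.
rewrite mule1 (_ : (_ `\ _)%fset = [fset i]%fset) ?big_seq_fset1//.
by apply/fsetP => j; rewrite !inE; case: (j =P i) => [->|_]; rewrite ?ki ?andbF.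
Qed.

Lemma resampled_indep P rho k : independent_coords P ->
  independent_coords (resampled P rho k).
Proof.
move=> indP J B mB; rewrite -/(rect J B) resampled_rect//.
under [RHS]eq_bigr do rewrite resampled_marginal//.
have H K : k \notin K -> (\prod_(i <- K) marginal P i (B i) =
   \prod_(i <- K) (if i == k then rho (B i) else marginal P i (B i)))%E.
  move=> kK; rewrite !big_seq; apply: eq_bigr => i iK; case: eqP => // ik.
  by rewrite ik (negPf kK) in iK.
case: ifPn => kJ.
  rewrite (big_fsetD1 k kJ)/= eqxx muleC; congr (_ * _)%E.
  by apply: H; rewrite !inE eqxx.
by rewrite mule1 mem_fsetD1// H.
Qed.

(** Both laws give a rectangle the product of the marginals of its sides,
    whether or not it constrains the resampled coordinate. *)
Lemma resampledE P (rho : probability (borelRn R q) R) k : independent_coords P ->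
  (forall A, measurable A -> marginal P k A = rho A) ->
  forall A, measurable A -> resampled P rho k A = P A.
Proof.
move=> indP mk; apply: eq_rect_measure => J B mB.
apply: (eq_trans (resampled_rect _ _ _ indP mB)).
apply: (eq_trans _ (esym (indP _ _ mB))); case: ifPn => kJ.
  by rewrite (big_fsetD1 k kJ)/= muleC mk.
by rewrite mule1 mem_fsetD1.
Qed.

Lemma ge0_integral_resample P (rho : probability (borelRn R q) R) k (F : famRn R q I -> \bar R) :
  independent_coords P ->
  (forall A, measurable A -> marginal P k A = rho A) ->
  measurable_fun setT F -> (forall w, 0 <= F w)%E ->
  (\int[P]_w F w = \int[P]_w \int[rho]_w0 F (resample k (w, w0)))%E.
Proof.
move=> indP mk mF F0.
rewrite (@eq_measure_integral _ _ _ _ (resampled P rho k)); last first.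
  by move=> A mA _; exact/esym/(resampledE indP mk).
rewrite ge0_integral_pushforward// preimage_setT fubini_tonelli1//=.
exact: measurableT_comp.
Qed.

Lemma integral_resample P (rho : probability (borelRn R q) R) k (F : famRn R q I -> \bar R) :
  independent_coords P ->
  (forall A, measurable A -> marginal P k A = rho A) ->
  P.-integrable setT F ->
  (\int[P]_w F w = \int[P]_w \int[rho]_w0 F (resample k (w, w0)))%E.
Proof.
move=> indP mk intF; have mF := measurable_int _ intF.
have intF' : (P \x rho)%E.-integrable setT (F \o resample k).
  apply/integrableP; split; first exact: measurableT_comp.
  move/integrableP: intF => [_].
  rewrite (@eq_measure_integral _ _ _ _ (resampled P rho k)); last first.
    by move=> A mA _; exact/esym/(resampledE indP mk).
  rewrite ge0_integral_pushforward//.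
  exact: measurableT_comp.
rewrite (@eq_measure_integral _ _ _ _ (resampled P rho k)); last first.
  by move=> A mA _; exact/esym/(resampledE indP mk).
by rewrite integral_pushforward// preimage_setT -fubini1.
Qed.

End Resampling.
End Families.

(** * Expectations of almost surely bounded random variables *)

Section Expectations.
Context d (T : measurableType d) {R : realType}.

(** [Om] is meant to have full measure, such as the event that all disturbances
    are possible ones.  Boundedness is stable under sums and products, so it is
    an easier invariant than integrability. *)
Definition bounded_on (Om : set T) (f : T -> R) : Prop :=
  measurable_fun setT f /\ exists M, forall t, Om t -> `|f t| <= M.

Definition bounded_vec_on (Om : set T) n (f : T -> 'cV[R]_n) : Prop :=
  forall i, bounded_on Om (fun t => f t i 0).

Section Closure.
Variable Om : set T.

Lemma bounded_on_cst c : bounded_on Om (fun=> c).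
Proof. by split; [exact: measurable_cst|exists `|c|]. Qed.

Lemma bounded_onD f g : bounded_on Om f -> bounded_on Om g ->
  bounded_on Om (fun t => f t + g t).
Proof.
move=> [mf [M fM]] [mg [K gK]]; split; first exact: measurable_funD.
exists (M + K) => t Ot; rewrite (le_trans (ler_normD _ _))// lerD//; [exact: fM|exact: gK].
Qed.

Lemma bounded_onM f g : bounded_on Om f -> bounded_on Om g ->
  bounded_on Om (fun t => f t * g t).
Proof.
move=> [mf [M fM]] [mg [K gK]]; split; first exact: measurable_funM.
by exists (M * K) => t Ot; rewrite normrM ler_pM//; [exact: fM|exact: gK].
Qed.

Lemma bounded_on_sum (I : Type) (r : seq I) (p : pred I) (f : I -> T -> R) :
  (forall i, bounded_on Om (f i)) ->
  bounded_on Om (fun t => \sum_(i <- r | p i) f i t).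
Proof.
move=> bf; elim: r => [|i r IH].
  rewrite (_ : (fun _ => _) = fun=> 0); first exact: bounded_on_cst.
  by apply/funext => t; rewrite big_nil.
rewrite (_ : (fun _ => _) = fun t => (if p i then f i t else 0) +
   \sum_(i <- r | p i) f i t).
  apply: bounded_onD => //; case: (p i) => //; exact: bounded_on_cst.
by apply/funext => t; rewrite big_cons; case: (p i); rewrite ?add0r.
Qed.

Lemma bounded_vec_cst n (c : 'cV[R]_n) : bounded_vec_on Om (fun=> c).
Proof. by move=> i; exact: bounded_on_cst. Qed.

Lemma bounded_vecD n (f g : T -> 'cV[R]_n) :
  bounded_vec_on Om f -> bounded_vec_on Om g ->
  bounded_vec_on Om (fun t => f t + g t).
Proof.
move=> bf bg i; rewrite (_ : (fun _ => _) = fun t => f t i 0 + g t i 0).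
  exact: bounded_onD.
by apply/funext => t; rewrite mxE.
Qed.

Lemma bounded_vecM n p (M : 'M[R]_(p, n)) (f : T -> 'cV[R]_n) :
  bounded_vec_on Om f -> bounded_vec_on Om (fun t => M *m f t).
Proof.
move=> bf i; rewrite (_ : (fun _ => _) = fun t => \sum_j M i j * f t j 0).
  by apply: bounded_on_sum => j; apply: bounded_onM; [exact: bounded_on_cst|exact: bf].
by apply/funext => t; rewrite mxE.
Qed.

Lemma bounded_vecB n (f g : T -> 'cV[R]_n) :
  bounded_vec_on Om f -> bounded_vec_on Om g ->
  bounded_vec_on Om (fun t => f t - g t).
Proof.
move=> bf bg i; rewrite (_ : (fun _ => _) = fun t => f t i 0 + (-1) * g t i 0).
  by apply: bounded_onD => //; apply: bounded_onM => //; exact: bounded_on_cst.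
by apply/funext => t; rewrite !mxE mulN1r.
Qed.

Lemma bounded_vec_sum n (I : Type) (r : seq I) (p : pred I) (f : I -> T -> 'cV[R]_n) :
  (forall i, bounded_vec_on Om (f i)) ->
  bounded_vec_on Om (fun t => \sum_(i <- r | p i) f i t).
Proof.
move=> bf j; rewrite (_ : (fun _ => _) = fun t => \sum_(i <- r | p i) f i t j 0).
  by apply: bounded_on_sum => i; exact: bf.
by apply/funext => t; rewrite summxE.
Qed.

Lemma bounded_form n p (L : 'M[R]_(n, p)) (f : T -> 'cV[R]_n) (g : T -> 'cV[R]_p) :
  bounded_vec_on Om f -> bounded_vec_on Om g ->
  bounded_on Om (fun t => ((f t)^T *m L *m g t) 0 0).
Proof.
move=> bf bg; rewrite (_ : (fun _ => _) =
  fun t => \sum_j (\sum_i f t i 0 * L i j) * g t j 0).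
  apply: bounded_on_sum => j; apply: bounded_onM; last exact: bg.
  by apply: bounded_on_sum => i; apply: bounded_onM; [exact: bf|exact: bounded_on_cst].
apply/funext => t; rewrite mxE; apply: eq_bigr => j _; rewrite mxE; congr (_ * _).
by apply: eq_bigr => i _; rewrite mxE.
Qed.

Lemma bounded_qform n (S : 'M[R]_n) (f : T -> 'cV[R]_n) :
  bounded_vec_on Om f -> bounded_on Om (fun t => qform S (f t)).
Proof. by move=> bf; exact: bounded_form. Qed.

End Closure.

Definition Ex (P : probability T R) (f : T -> R) : R := \int[P]_t f t.

Section Linearity.
Variables (P : probability T R) (Om : set T).
Hypothesis aeOm : {ae P, forall t, Om t}.

Lemma bounded_integrable f : bounded_on Om f -> P.-integrable setT (EFin \o f).
Proof.
move=> [mf [M fM]]; apply/integrableP; split; first exact/measurable_EFinP.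
apply: (@le_lt_trans _ _ (\int[P]_t (Num.max M 0)%:E)%E).
  apply: ae_ge0_le_integral => //.
  - by apply: measurableT_comp => //; exact/measurable_EFinP.
  - by move=> t _; rewrite lee_fin le_max lexx orbT.
  - apply: filterS aeOm => t Ot _ /=.
    by rewrite lee_fin le_max fM.
by rewrite integral_cst//= probability_setT mule1 ltry.
Qed.

Lemma expectationE f : bounded_on Om f -> ('E_P[f] = (Ex P f)%:E)%E.
Proof.
move=> bf; rewrite unlock /Ex /Rintegral fineK//.
exact/(integrable_fin_num measurableT)/bounded_integrable.
Qed.

Lemma integralEx f : bounded_on Om f -> (\int[P]_t (f t)%:E = (Ex P f)%:E)%E.
Proof. by move=> bf; rewrite -expectationE// unlock. Qed.

Lemma Ex_cst c : Ex P (fun=> c) = c.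
Proof.
rewrite /Ex /Rintegral integral_cst//=.
by rewrite [X in (_ * X)%E](@probability_setT _ _ _ P) mule1.
Qed.

Lemma ExD f g : bounded_on Om f -> bounded_on Om g ->
  Ex P (fun t => f t + g t) = Ex P f + Ex P g.
Proof. by move=> bf bg; apply: RintegralD => //; exact: bounded_integrable. Qed.

Lemma ExZ c f : bounded_on Om f -> Ex P (fun t => c * f t) = c * Ex P f.
Proof. by move=> bf; apply: RintegralZl => //; exact: bounded_integrable. Qed.

Lemma Ex_sum (I : Type) (r : seq I) (p : pred I) (f : I -> T -> R) :
  (forall i, bounded_on Om (f i)) ->
  Ex P (fun t => \sum_(i <- r | p i) f i t) = \sum_(i <- r | p i) Ex P (f i).
Proof.
move=> bf; elim: r => [|i r IH].
  rewrite big_nil (_ : (fun _ => _) = fun=> 0) ?Ex_cst//.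
  by apply/funext => t; rewrite big_nil.
rewrite big_cons; case: ifPn => pi.
  rewrite -IH -ExD//; last exact: bounded_on_sum.
  by congr Ex; apply/funext => t; rewrite big_cons pi.
by rewrite -IH; congr Ex; apply/funext => t; rewrite big_cons (negPf pi).
Qed.

Lemma Ex_ge0 f : bounded_on Om f -> (forall t, Om t -> 0 <= f t) -> 0 <= Ex P f.
Proof.
move=> bf f0; have intf := bounded_integrable bf.
rewrite /Ex /Rintegral fine_ge0//.
have -> : (\int[P]_t (f t)%:E = \int[P]_t (Num.max (f t) 0)%:E)%E.
  have mf : measurable_fun setT f by case: bf.
  apply: ae_eq_integral => //; first exact/measurable_EFinP.
    by apply/measurable_EFinP; apply: measurable_maxr.
  by apply: filterS aeOm => t /f0 f0t _; congr EFin; rewrite max_l.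
by apply: integral_ge0 => t _; rewrite lee_fin le_max lexx orbT.
Qed.

Lemma Ex_le f g : bounded_on Om f -> bounded_on Om g ->
  (forall t, Om t -> f t <= g t) -> Ex P f <= Ex P g.
Proof.
move=> bf bg fg; rewrite -subr_ge0.
have bNf : bounded_on Om (fun t => -1 * f t).
  by apply: bounded_onM => //; exact: bounded_on_cst.
rewrite -mulN1r -ExZ// -ExD//; apply: Ex_ge0; first exact: bounded_onD.
by move=> t Ot; rewrite mulN1r subr_ge0; exact: fg.
Qed.

End Linearity.
End Expectations.

Lemma Ex_distribution d d' (T : measurableType d) (T' : measurableType d')
    (R : realType) (P : probability T R) (phi : {mfun T >-> T'}) (f : T' -> R) :
  measurable_fun setT f -> P.-integrable setT (EFin \o (f \o phi)) ->
  Ex (distribution P phi) f = Ex P (f \o phi).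
Proof.
move=> mf intf; rewrite /Ex /Rintegral; congr fine.
rewrite [LHS](@integral_pushforward _ _ _ _ _ phi)//.
exact/measurable_EFinP.
Qed.

(** * Zero-mean independent disturbances *)

Section SingleDisturbance.
Context {R : realType} {q : nat}.
Variables (W : set 'cV[R]_q).
Hypotheses (cW : closed W) (bW : bounded_set W).

Lemma bounded_set_bound : exists2 M, 0 <= M & forall w, W w -> `|w| <= M.
Proof.
have [M [_ MW]] := bW; exists (Num.max M 0 + 1).
  by rewrite addr_ge0// le_max lexx orbT.
by move=> w Ww; apply: MW => //; rewrite ltr_pwDr// le_max lexx.
Qed.

Lemma bounded_id : bounded_vec_on (W : set (borelRn R q)) (fun w : borelRn R q => (w : 'cV[R]_q)).
Proof.
move=> j; split; first exact: measurable_entry.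
have [M _ MW] := bounded_set_bound; exists M => w Ww.
by rewrite (le_trans (mx_norm_entry _ _ _))// MW.
Qed.

Variable rho : probability (borelRn R q) R.
Hypothesis zm : zero_mean_on W rho.

Lemma ae_disturbance : {ae rho, forall w, W w}.
Proof.
exists (~` W); split=> //.
  by apply: measurableC; exact: closed_borel.
rewrite probability_setC; last exact: closed_borel.
have [_ W1] := zm; rewrite [X in (_ - X)%E]W1; exact: subee.
Qed.

Lemma Ex_entry0 j : Ex rho (fun w : borelRn R q => (w : 'cV[R]_q) j 0) = 0.
Proof.
have [H _] := zm; have := H j; rewrite (expectationE ae_disturbance)//.
  by case.
exact: bounded_id.
Qed.

Lemma Ex_form0 n (a : 'cV[R]_n) (L : 'M[R]_(n, q)) :
  Ex rho (fun w : borelRn R q => (a^T *m L *m (w : 'cV[R]_q)) 0 0) = 0.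
Proof.
rewrite (_ : (fun _ => _) =
   fun w : borelRn R q => \sum_j (a^T *m L) 0 j * (w : 'cV[R]_q) j 0); last first.
  by apply/funext => w; rewrite mxE.
have bj j := bounded_id j.
rewrite (Ex_sum ae_disturbance); last first.
  by move=> j; apply: bounded_onM => //; exact: bounded_on_cst.
by rewrite big1// => j _; rewrite (ExZ ae_disturbance)// Ex_entry0 mulr0.
Qed.

End SingleDisturbance.

Section Disturbances.
Context {R : realType} {q : nat} {I : countType}.
Variables (W : set 'cV[R]_q) (P : probability (famRn R q I) R).
Hypotheses (cW : closed W) (bW : bounded_set W).
Hypothesis indP : independent_coords P.
Hypothesis zmP : forall i, zero_mean_on W (marginal P i).

Definition in_all : set (famRn R q I) := [set w | forall i, W (w i)].

Lemma measurable_in_all : measurable in_all.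
Proof.
have -> : in_all = \bigcap_k (if @choice.unpickle I k is Some i
   then @Defs.coord R q I i @^-1` W else setT).
  apply/seteqP; split=> w /=.
    by move=> Ww k _; case: choice.unpickle.
  by move=> H i; have := H (choice.pickle i) Logic.I; rewrite choice.pickleK.
apply: bigcapT_measurable => k; case: choice.unpickle => // i.
rewrite -[X in measurable X]setTI; apply: measurable_coord => //.
exact: closed_borel.
Qed.

Lemma ae_in_all : {ae P, forall w, in_all w}.
Proof.
have H k : {ae P, forall w, if @choice.unpickle I k is Some i then W (w i) else True}.
  case: choice.unpickle => [i|]; last exact: aeW.
  exists (~` (@Defs.coord R q I i @^-1` W)); split=> //.
    apply: measurableC; rewrite -[X in measurable X]setTI.
    by apply: measurable_coord => //; exact: closed_borel.
  rewrite probability_setC; last first.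
    rewrite -[X in measurable X]setTI.
    by apply: measurable_coord => //; exact: closed_borel.
  have [_ W1] := zmP i; rewrite [X in (_ - X)%E]W1.
  by rewrite subee.
have := ae_foralln H; apply: filterS => w Hw i.
by have := Hw (choice.pickle i); rewrite choice.pickleK.
Qed.

Lemma bounded_coord i : bounded_vec_on in_all (fun w => w i).
Proof.
move=> j; split.
  exact: (measurable_vec_entry j (measurable_coord i)).
have [M _ MW] := bounded_set_bound bW; exists M => w Ww.
by rewrite (le_trans (mx_norm_entry _ _ _))// MW//; exact: Ww.
Qed.

(** Integrating over [w k] first leaves the mean of [w k], which is zero, as
    resampling [w k] does not affect [a]. *)
Lemma Ex_cross0 n k (a : famRn R q I -> 'cV[R]_n) (L : 'M[R]_(n, q)) :
  bounded_vec_on in_all a ->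
  (forall w w0, a (resample k (w, w0)) = a w) ->
  Ex P (fun w => ((a w)^T *m L *m w k) 0 0) = 0.
Proof.
move=> ba aI.
have bf : bounded_on in_all (fun w : famRn R q I => ((a w)^T *m L *m w k) 0 0).
  by apply: bounded_form => //; exact: bounded_coord.
apply: EFin_inj; rewrite -(integralEx ae_in_all bf).
rewrite (integral_resample (rho := marginal P k) (k := k) indP)//; last first.
  exact: (bounded_integrable ae_in_all bf).
under eq_integral => w _.
  under eq_integral => w0 _ do rewrite aI /resample eqxx /=.
  rewrite (integralEx (ae_disturbance cW (zmP k))); last first.
    by apply: bounded_form; [exact: bounded_vec_cst|exact: bounded_id].
  rewrite (Ex_form0 cW bW (zmP k)).
  over.
exact: integral0.
Qed.

(** Jensen's inequality in coordinate [k]: its mean is zero, so in the square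
    of an affine function of it the cross term vanishes, and the remaining
    quadratic term is nonnegative. *)
Lemma Ex_qform_jensen n k (S : 'M[R]_n) (L : 'M[R]_(n, q))
    (f : famRn R q I -> 'cV[R]_n) : psdmx S ->
  bounded_vec_on in_all f ->
  (forall w w0, f (resample k (w, w0)) = f (resample k (w, 0)) + L *m w0) ->
  Ex P (fun w => qform S (f (resample k (w, 0)))) <= Ex P (fun w => qform S (f w)).
Proof.
move=> [symS S0] bf fL.
pose g (w : famRn R q I) := f (resample k (w, 0)).
have fE w : f w = g w + L *m w k.
  by rewrite -fL; congr f; apply/funext => i; rewrite /resample /=; case: eqP => // ->.
have bL : bounded_vec_on in_all (fun w : famRn R q I => L *m w k).
  by apply: bounded_vecM; exact: bounded_coord.
have bg : bounded_vec_on in_all g.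
  rewrite (_ : g = fun w => f w - L *m w k); first exact: bounded_vecB.
  by apply/funext => w; rewrite fE addrK.
have -> : (fun w => qform S (f w)) = (fun w => qform S (g w) +
    (2 * ((g w)^T *m (S *m L) *m w k) 0 0 + qform S (L *m w k))).
  by apply/funext => w; rewrite fE qformD// -addrA !mulmxA.
have bc : bounded_on in_all (fun w : famRn R q I => ((g w)^T *m (S *m L) *m w k) 0 0).
  by apply: bounded_form => //; exact: bounded_coord.
have b2c : bounded_on in_all
    (fun w : famRn R q I => 2 * ((g w)^T *m (S *m L) *m w k) 0 0).
  by apply: bounded_onM => //; exact: bounded_on_cst.
have bq := bounded_qform S bL; have bqg := bounded_qform S bg.
rewrite (ExD ae_in_all)//; last exact: bounded_onD.
rewrite (ExD ae_in_all)// (ExZ ae_in_all)// Ex_cross0// => [|w w0].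
  rewrite mulr0 add0r lerDl; apply: (Ex_ge0 ae_in_all) => // w _; exact: S0.
rewrite /g; congr f; apply/funext => i; rewrite /resample /=.
by case: eqP.
Qed.

End Disturbances.

(** * Independent families with a given common law *)

Section ProductLaw.
Context {R : realType} {q : nat} {I : finType}.

Lemma dirac_indep (w0 : famRn R q I) :
  independent_coords (\d_w0 : probability (famRn R q I) R).
Proof.
have dE A : (\d_w0 : probability (famRn R q I) R) A = (w0 \in A)%:R%:E.
  exact (@diracE _ _ R w0 A).
move=> J B mB; apply: (eq_trans (dE _)).
have mE i : marginal (\d_w0 : probability (famRn R q I) R) i (B i) =
    ((w0 i \in B i)%:R)%:E.
  by apply: (eq_trans (dE _)).
under [RHS]eq_bigr do rewrite mE.
rewrite prodEFin -natr_prod; congr (_%:R)%:E.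
have [H|/existsNP[i /not_implyP[iJ iB]]] := pselect (forall i, i \in J -> B i (w0 i)).
  rewrite mem_set// big_seq big1// => i iJ; rewrite mem_set//; exact: H.
rewrite memNset; last by move=> /= /(_ _ iJ).
by rewrite (big_fsetD1 i iJ)/= memNset.
Qed.

(** Starting from a deterministic family, resample all coordinates in turn. *)
Lemma iid_ex (rho : probability (borelRn R q) R) :
  exists P : probability (famRn R q I) R, independent_coords P /\
    forall i A, measurable A -> marginal P i A = rho A.
Proof.
suff [P [indP mP]] : exists P : probability (famRn R q I) R, independent_coords P /\
    forall i A, i \in enum I -> measurable A -> marginal P i A = rho A.
  by exists P; split=> // i A; apply: mP; rewrite mem_enum.
elim: (enum I) => [|k s [P [indP mP]]].
  by exists (\d_((fun=> 0) : famRn R q I)); split; [exact: dirac_indep|].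
exists (resampled P rho k); split; first exact: resampled_indep.
move=> i A; rewrite inE => iks mA; rewrite resampled_marginal//.
by case: eqP iks => //= ik /mP; exact.
Qed.

End ProductLaw.

Section SameLaw.
Context {R : realType} {q : nat}.
Variables (P1 P2 : probability (borelRn R q) R).
Hypothesis P12 : forall A, measurable A -> P1 A = P2 A.

Lemma eq_law_expectation f : ('E_P1[f] = 'E_P2[f])%E.
Proof. by rewrite unlock; apply: eq_measure_integral => A mA _; exact: P12. Qed.

Lemma eq_law_moment : second_moment P1 = second_moment P2.
Proof. by apply/matrixP => i j; rewrite !mxE eq_law_expectation. Qed.

Lemma eq_law_zero_mean W : closed W -> zero_mean_on W P2 -> zero_mean_on W P1.
Proof.
move=> cW [H1 H2]; split=> [i|]; first by rewrite eq_law_expectation.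
by rewrite P12//; exact: closed_borel.
Qed.

End SameLaw.

(** The nominal covariance is that of a possible disturbance, of which
    independent copies are taken. *)
Lemma ambiguity_product_ex (R : realType) q N (W : set 'cV[R]_q) d : closed W ->
  admissible W d -> exists P, ambiguity_product (I := 'I_N.+1) W d P.
Proof.
move=> cW [d1 d2 H].
have [rho zm rhoE] := H _ (gelbrich_ball_center d1 d2).
have [P [indP mP]] := @iid_ex R q 'I_N.+1 rho.
exists P; split=> // k; split; first exact: (eq_law_zero_mean (mP k)).
rewrite (eq_law_moment (mP k)) -rhoE; exact: gelbrich_ball_center.
Qed.

(** * Causal affine maps of the disturbance sequence *)

Section CausalAffine.
Context {R : realType} {q N : nat}.
Implicit Types (w : 'I_N.+1 -> 'cV[R]_q).

Definition causal_affine p (i : nat) (f : ('I_N.+1 -> 'cV[R]_q) -> 'cV[R]_p) :=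
  exists c (C : 'I_N.+1 -> 'M[R]_(p, q)),
    (forall j : 'I_N.+1, (i <= j)%N -> C j = 0) /\
    forall w, f w = c + \sum_j C j *m w j.

Lemma causal_cst p i (c : 'cV[R]_p) : causal_affine i (fun=> c).
Proof.
exists c, (fun=> 0); split=> // w.
by rewrite big1 ?addr0// => j _; rewrite mul0mx.
Qed.

Lemma causalD p i (f g : ('I_N.+1 -> 'cV[R]_q) -> 'cV[R]_p) :
  causal_affine i f -> causal_affine i g ->
  causal_affine i (fun w => f w + g w).
Proof.
move=> [c [C [C0 fE]]] [d [E [E0 gE]]]; exists (c + d), (fun j => C j + E j).
split=> [j ij|w]; first by rewrite C0// E0// addr0.
rewrite fE gE addrACA -big_split /=; congr (_ + _).
by apply: eq_bigr => j _; rewrite mulmxDl.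
Qed.

Lemma causalM p r i (M : 'M[R]_(r, p)) (f : ('I_N.+1 -> 'cV[R]_q) -> 'cV[R]_p) :
  causal_affine i f -> causal_affine i (fun w => M *m f w).
Proof.
move=> [c [C [C0 fE]]]; exists (M *m c), (fun j => M *m C j).
split=> [j ij|w]; first by rewrite C0// mulmx0.
rewrite fE mulmxDr mulmx_sumr; congr (_ + _).
by apply: eq_bigr => j _; rewrite mulmxA.
Qed.

Lemma causalB p i (f g : ('I_N.+1 -> 'cV[R]_q) -> 'cV[R]_p) :
  causal_affine i f -> causal_affine i g ->
  causal_affine i (fun w => f w - g w).
Proof.
move=> cf cg.
rewrite (_ : (fun _ => _) = fun w => f w + (- 1%:M) *m g w).
  by apply: causalD => //; exact: causalM.
by apply/funext => w; rewrite mulNmx mul1mx.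
Qed.

Lemma causal_le p i j (f : ('I_N.+1 -> 'cV[R]_q) -> 'cV[R]_p) : (i <= j)%N ->
  causal_affine i f -> causal_affine j f.
Proof.
move=> ij [c [C [C0 fE]]]; exists c, C; split=> // k jk.
by apply: C0; exact: leq_trans jk.
Qed.

Lemma causal_coord i (k : 'I_N.+1) : (k < i)%N -> causal_affine i (fun w => w k).
Proof.
move=> ki; exists 0, (fun j => if j == k then 1%:M else 0); split=> [j ij|w].
  by case: eqP => // jk; rewrite jk leqNgt ki in ij.
rewrite add0r (bigD1 k)//= eqxx mul1mx big1 ?addr0// => j /negPf ->.
by rewrite mul0mx.
Qed.

(** Along [delay w0 w] a prediction made now passes, after the disturbance [w0],
    through what is predicted at the next time along [w]. *)
Definition delay (w0 : 'cV[R]_q) w : 'I_N.+1 -> 'cV[R]_q :=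
  fun i => if i == ord0 then w0 else w (inord i.-1).

Lemma causal_delay p i (w0 : 'cV[R]_q) (f : ('I_N.+1 -> 'cV[R]_q) -> 'cV[R]_p) :
  causal_affine i.+1 f -> causal_affine i (fun w => f (delay w0 w)).
Proof.
move=> [c [C [C0 fE]]].
exists (c + C ord0 *m w0), (fun j => if (j < N)%N then C (inord j.+1) else 0).
split=> [j ij|w].
  by case: ifP => // jN; rewrite C0// inordK.
rewrite fE -addrA; congr (_ + _); rewrite big_ord_recl {1}/delay eqxx; congr (_ + _).
rewrite big_ord_recr /= ltnn mul0mx addr0; apply: eq_bigr => j _.
rewrite ltn_ord /delay -(inj_eq val_inj) /=; congr (C _ *m w _).
  by apply: val_inj; rewrite /= inordK// ltnS.
by apply: val_inj; rewrite /= add0n inordK// ltnS ltnW.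
Qed.

Lemma causal_comb p i (f : ('I_N.+1 -> 'cV[R]_q) -> 'cV[R]_p) t w1 w2 :
  causal_affine i f ->
  f (fun j => (1 - t) *: w1 j + t *: w2 j) = (1 - t) *: f w1 + t *: f w2.
Proof.
move=> [c [C [_ fE]]]; rewrite !fE !scalerDr addrACA -scalerDl subrK scale1r.
congr (_ + _); rewrite !scaler_sumr -big_split; apply: eq_bigr => j _.
by rewrite mulmxDr -!scalemxAr.
Qed.

Lemma causal_resample p i (f : ('I_N.+1 -> 'cV[R]_q) -> 'cV[R]_p) :
  causal_affine i f -> exists L : 'I_N.+1 -> 'M[R]_(p, q),
    (forall j : 'I_N.+1, (i <= j)%N -> L j = 0) /\
    forall (k : 'I_N.+1) w (w0 : 'cV[R]_q), f (resample k (w, w0)) = f (resample k (w, 0)) + L k *m w0.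
Proof.
move=> [c [C [C0 fE]]]; exists C; split=> // k w w0; rewrite !fE -addrA.
congr (_ + _); rewrite (bigD1 k)//= [in RHS](bigD1 k)//= /resample /= eqxx.
rewrite mulmx0 add0r addrC; congr (_ + _); apply: eq_bigr => j /negPf jk.
by rewrite jk.
Qed.

Lemma causal_indep p i (k : 'I_N.+1) (f : ('I_N.+1 -> 'cV[R]_q) -> 'cV[R]_p) w (w0 : 'cV[R]_q) :
  causal_affine i f -> (i <= k)%N -> f (resample k (w, w0)) = f w.
Proof.
move=> [c [C [C0 fE]]] ik; rewrite !fE; congr (_ + _); apply: eq_bigr => j _.
rewrite /resample; case: eqP => [->|//].
by rewrite C0// !mul0mx.
Qed.

End CausalAffine.

(** * Predicted trajectories *)

Section Prediction.
Context {R : realType} {n m q N : nat}.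

Lemma pred_input0 (th : policy R m q N) w : pred_input th w ord0 = th.2 ord0.
Proof. by rewrite /pred_input big_pred0 ?addr0. Qed.

Lemma causal_pred_input (th : policy R m q N) (i : 'I_N.+1) : causal_affine i (pred_input th ^~ i).
Proof.
exists (th.2 i), (fun j : 'I_N.+1 => if (j < i)%N then th.1 i j else 0); split=> [j ij|w].
  by rewrite ltnNge ij.
rewrite /pred_input [in LHS]big_mkcond /=; congr (_ + _); apply: eq_bigr => j _.
by case: ifP => // _; rewrite mul0mx.
Qed.

(** Feedback rules and tails of policies can thus be given by their inputs
    instead of by blocks. *)
Lemma policy_of_causal (f : 'I_N.+1 -> ('I_N.+1 -> 'cV[R]_q) -> 'cV[R]_m) :
  (forall i : 'I_N.+1, causal_affine i (f i)) ->
  exists th : policy R m q N, causal th /\ forall w i, pred_input th w i = f i w.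
Proof.
move=> cf.
have [c cP] := choice cf; have [C CP] := choice cP.
exists (C, c); split=> [i j ij|w i]; first by have [C0 _] := CP i; exact: C0.
have [C0 ->] := CP i; rewrite /pred_input big_mkcond /=; congr (_ + _).
apply: eq_bigr => j _; case: ltnP => // ij.
by rewrite C0// mul0mx.
Qed.

Variable D : mpc_data R n m q.
Local Notation A := (sysA D).
Local Notation B := (sysB D).
Local Notation G := (sysG D).
Local Notation K := (terminal_gain D).

Lemma causal_pred_state x (th : policy R m q N) k : (k <= N.+1)%N ->
  causal_affine k (fun w => pred_state D x th w k).
Proof.
elim: k => [|k IH] kN /=; first exact: causal_cst.
have ki : (inord k : 'I_N.+1) = k :> nat by rewrite inordK.
apply: causalD; last by apply/causalM/causal_coord; rewrite ki.
apply: causalD; apply: causalM.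
  by apply: (causal_le (leqnSn k)); apply: IH; exact: ltnW.
by apply: (@causal_le _ _ _ _ k) => //; rewrite -{1}ki; exact: causal_pred_input.
Qed.

Lemma pred_stateS x (th : policy R m q N) w (k : 'I_N.+1) :
  pred_state D x th w k.+1 =
  A *m pred_state D x th w k + B *m pred_input th w k + G *m w k.
Proof. by rewrite /= inord_val. Qed.

(** Policies see disturbances, not states; linear feedback is one of them because
    the states that it produces are causal affine in the disturbances. *)
Lemma feedback_policy x : exists th : policy R m q N, causal th /\
  forall w (i : 'I_N.+1), pred_input th w i = K *m pred_state D x th w i.
Proof.
pose fix lin (w : 'I_N.+1 -> 'cV[R]_q) (k : nat) : 'cV[R]_n :=
  if k is j.+1 then A *m lin w j + B *m (K *m lin w j) + G *m w (inord j) else x.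
have clin k : (k <= N.+1)%N -> causal_affine k (lin ^~ k).
  elim: k => [|k IH] kN /=; first exact: causal_cst.
  have IHk := causal_le (leqnSn k) (IH (ltnW kN)).
  apply: causalD; last by apply/causalM/causal_coord; rewrite inordK.
  by apply: causalD; apply: causalM => //; exact: causalM.
have cf (i : 'I_N.+1) : causal_affine i (fun w => K *m lin w i).
  by apply/causalM/clin; exact: ltnW.
have [th [cth thE]] := policy_of_causal cf.
exists th; split=> // w i; rewrite thE; congr (_ *m _).
have : (i <= N.+1)%N by exact: ltnW.
elim: (nat_of_ord i) => [//|k IH] kN /=.
by rewrite thE inordK// IH// ltnW.
Qed.

(** The candidate for the next time: the remaining inputs of the policy, then the
    terminal gain.  Here [w] still starts with the current disturbance, known by
    the time that the candidate is used. *)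
Definition tail_input x (th : policy R m q N) (w : 'I_N.+1 -> 'cV[R]_q)
    (k : 'I_N.+1) : 'cV[R]_m :=
  if (k < N)%N then pred_input th w (inord k.+1)
  else K *m pred_state D x th w N.+1.

Definition next_state x (u : 'cV[R]_m) w0 := A *m x + B *m u + G *m w0.

Lemma causal_tail_input x (th : policy R m q N) (k : 'I_N.+1) :
  causal_affine k.+1 (tail_input x th ^~ k).
Proof.
rewrite /tail_input; case: ltnP => kN.
  have e : (inord k.+1 : 'I_N.+1) = k.+1 :> nat by rewrite inordK.
  by rewrite -{1}e; exact: causal_pred_input.
apply: causalM; rewrite (_ : k.+1 = N.+1); first exact: causal_pred_state.
by congr _.+1; apply/eqP; rewrite eqn_leq kN -ltnS ltn_ord.
Qed.

Definition is_tail x (th : policy R m q N) w0 (th' : policy R m q N) :=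
  causal th' /\ forall w k, pred_input th' w k = tail_input x th (delay w0 w) k.

Lemma tail_policy x th w0 : exists th', is_tail x th w0 th'.
Proof.
have [th' [cth' th'E]] := policy_of_causal
  (fun i => causal_delay w0 (causal_tail_input x th i)).
by exists th'.
Qed.

Lemma tail_state x th w0 th' w k : is_tail x th w0 th' -> (k <= N)%N ->
  pred_state D (next_state x (th.2 ord0) w0) th' w k =
  pred_state D x th (delay w0 w) k.+1.
Proof.
move=> [_ th'E]; elim: k => [|k IH] kN.
  rewrite /next_state /= (_ : inord 0 = ord0) ?pred_input0 ?/delay ?eqxx//.
  by apply: val_inj; rewrite /= inordK.
have kN' : (k < N.+1)%N by rewrite ltnW.
rewrite [LHS]/= IH 1?ltnW// th'E /tail_input inordK// kN [RHS]/=.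
congr (_ + _ *m _); rewrite /delay -(inj_eq val_inj) /= inordK//=.
Qed.

Lemma tail_last_state x th w0 th' w (y := pred_state D x th (delay w0 w) N.+1) :
  is_tail x th w0 th' ->
  pred_state D (next_state x (th.2 ord0) w0) th' w N.+1 =
  next_state y (K *m y) (w ord_max).
Proof.
move=> tl; rewrite -[N.+1]/((@ord_max N).+1) pred_stateS tail_state//.
by case: tl => _ ->; rewrite /tail_input ltnn.
Qed.

Hypothesis hterm : forall x w, terminal D x -> disturbances D w ->
  constraints D (x, K *m x) /\ terminal D ((A + B *m K) *m x + G *m w).

Lemma terminal_next x w : terminal D x -> disturbances D w ->
  constraints D (x, K *m x) /\ terminal D (next_state x (K *m x) w).
Proof.
move=> Xx Ww; have [? ?] := hterm Xx Ww; split=> //.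
by rewrite /next_state mulmxA -mulmxDl.
Qed.

Lemma delay_in w0 w : disturbances D w0 -> (forall k, disturbances D (w k)) ->
  forall k, disturbances D (@delay R q N w0 w k).
Proof. by move=> W0 Ww k; rewrite /delay; case: ifP. Qed.

(** Delayed disturbances are possible ones, and the last input of the tail keeps
    the state in the terminal set: feasibility is recursive. *)
Lemma feasible_tail x th w0 th' : feasible_policies D x th ->
  disturbances D w0 -> is_tail x th w0 th' ->
  feasible_policies D (next_state x (th.2 ord0) w0) th'.
Proof.
move=> [_ F] W0 tl; split; first by case: tl.
move=> w Ww; have [FZ Ff] := F _ (delay_in W0 Ww).
have [TZ Tf] := terminal_next Ff (Ww ord_max).
split=> [k|]; last by rewrite tail_last_state.
have kN : (k <= N)%N by rewrite -ltnS.
rewrite tail_state//; case: tl => _ ->; rewrite /tail_input.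
case: ltnP => kN'; last by rewrite (_ : k.+1 = N.+1)//; congr _.+1; apply/eqP; rewrite eqn_leq kN.
by have := FZ (inord k.+1); rewrite inordK.
Qed.

Lemma feasible_feedback x th : terminal D x -> causal th ->
  (forall w (i : 'I_N.+1), pred_input th w i = K *m pred_state D x th w i) ->
  feasible_policies D x th.
Proof.
move=> Xx cth thE; split=> // w Ww.
have H k : (k <= N.+1)%N -> terminal D (pred_state D x th w k).
  elim: k => [//|k IH] kN /=.
  rewrite thE inordK//.
  by have [] := terminal_next (IH (ltnW kN)) (Ww (inord k)).
split=> [k|]; last exact: H.
by rewrite thE; have [] := terminal_next (H k (ltnW (ltn_ord k))) (Ww k).
Qed.

End Prediction.

(** * Permuted families of disturbances *)

Section RelabeledFamily.
Context {R : realType} {q : nat} {I : finType}.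

Definition relabel (s : {perm I}) (w : famRn R q I) : famRn R q I :=
  fun i => w (s i).

Lemma measurable_relabel s : measurable_fun setT (relabel s).
Proof. by apply: measurable_fam => i; exact: (measurable_coord (s i)). Qed.

HB.instance Definition _ s := isMeasurableFun.Build _ _ (famRn R q I)
  (famRn R q I) (relabel s) (measurable_relabel s).

Definition relabeled (P : probability (famRn R q I) R) s :
  probability (famRn R q I) R := distribution P (relabel s).

Lemma relabeled_indep P s : independent_coords P -> independent_coords (relabeled P s).
Proof.
move=> indP J B mB.
pose C i := B ((s^-1)%g i).
have -> : (\prod_(i <- J) marginal (relabeled P s) i (B i) =
   \prod_(i <- [fset s j | j in J]%fset) marginal P i (C i))%E.
  rewrite big_imfset /=; last by move=> i j _ _; exact: perm_inj.
  by apply: eq_bigr => i _; rewrite /C permK.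
rewrite -indP; last by move=> i; exact: mB.
rewrite [LHS]/(pushforward _ _ _) /pushforward; congr (P _).
apply/seteqP; split=> w /= H.
  by move=> _ /imfsetP[i /= iJ ->]; rewrite /C permK; exact: H.
move=> i iJ; have := H (s i); rewrite /C permK; apply.
by apply/imfsetP; exists i.
Qed.

Lemma relabeled_zero_mean P (s : {perm I}) W i :
  zero_mean_on W (marginal P (s i)) -> zero_mean_on W (marginal (relabeled P s) i).
Proof.
move=> [z1 z2]; split=> // j.
by rewrite (eq_law_expectation (P2 := marginal P (s i))).
Qed.

Lemma relabeled_ambiguity P s W d :
  ambiguity_product W d P -> ambiguity_product W d (relabeled P s).
Proof.
move=> [indP aP]; split; first exact: relabeled_indep.
move=> k; have [[z1 z2] ?] := aP (s k); split.
  exact: relabeled_zero_mean.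
rewrite (_ : second_moment _ = second_moment (marginal P (s k)))//.
exact: eq_law_moment.
Qed.

End RelabeledFamily.

(** * Completion of squares and expected horizon costs *)

Section Costs.
Context {R : realType} {n m q N : nat}.
Variable D : mpc_data R n m q.
Local Notation A := (sysA D).
Local Notation B := (sysB D).
Local Notation G := (sysG D).
Local Notation K := (terminal_gain D).
Local Notation Qc := (costQ D).
Local Notation Rc := (costR D).
Local Notation Pc := (costP D).
Local Notation W := (disturbances D).

Definition input_weight := Rc + B^T *m Pc *m B.
Local Notation S := input_weight.

(** Deviation of an input from the terminal gain, in the norm that it costs. *)
Definition deviation x u := qform S (u - K *m x).

Hypothesis psdQ : psdmx Qc.
Hypothesis pdR : pdmx Rc.
Hypothesis psdP : psdmx Pc.
Hypothesis riccati : Pc = A^T *m Pc *m A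
  - A^T *m Pc *m B *m invmx (Rc + B^T *m Pc *m B) *m B^T *m Pc *m A + Qc.

Lemma pd_input_weight : pdmx S.
Proof.
have [symR R0] := pdR; have [symP P0] := psdP; rewrite /S; split.
  by rewrite linearD /= symR !trmx_mul trmxK symP mulmxA.
by move=> x x0; rewrite qform_add -qformM ltr_wpDr ?P0 ?R0.
Qed.

Lemma psd_input_weight : psdmx S.
Proof. exact/pdmx_psd/pd_input_weight. Qed.

Lemma input_weight_unit : S \in unitmx.
Proof.
have pdS := pd_input_weight; have [symS _] := pdS.
rewrite -row_free_unit -kermx_eq0; apply/eqP/row_matrixP => i.
set v := row i _.
have vS : v *m S = 0 by apply/sub_kermxP; exact: row_sub.
have : qform S v^T <= 0 by rewrite /qform trmxK vS mul0mx mxE.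
by move/(pdmx_eq0 pdS) => /(congr1 trmx); rewrite trmxK trmx0 row0.
Qed.

(** The Riccati equation says that x'Px is the optimal cost to go of the
    undisturbed system, a departure from the gain K costing its deviation. *)
Lemma completion_of_squares x u :
  stage_cost D x u + qform Pc (A *m x + B *m u) = qform Pc x + deviation x u.
Proof.
have Su := input_weight_unit; have [symS _] := pd_input_weight.
have [symP _] := psdP.
pose H := B^T *m Pc *m A.
have KE : K = - (invmx S *m H) by rewrite /terminal_gain /H !mulmxA.
have SKx : S *m (K *m x) = - (H *m x).
  by rewrite KE mulNmx mulmxN -[invmx S *m H *m x]mulmxA mulKVmx.
have HT : A^T *m Pc *m B = H^T by rewrite /H !trmx_mul trmxK symP mulmxA.
have qK : qform S (K *m x) = (x^T *m (H^T *m invmx S *m H) *m x) 0 0.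
  rewrite /qform -mulmxA SKx mulmxN KE mulNmx [(- _)^T]linearN /= mulNmx opprK.
  rewrite !trmx_mul trmx_inv symS !mulmxA.
  by congr ((_ *m _ *m _ *m _ *m _) 0 0).
have qP : qform Pc x = qform (A^T *m Pc *m A) x
    - (x^T *m (H^T *m invmx S *m H) *m x) 0 0 + qform Qc x.
  rewrite {1}riccati /qform mulmxDr mulmxDl mulmxBr mulmxBl !mxE.
  congr (_ - _ + _).
  rewrite -HT /H /S !mulmxA; by [].
rewrite /deviation [qform S (u - _)]qformD// qformN mulmxN [X in _ + 2 * X]mxE.
have -> : (u^T *m S *m (K *m x)) 0 0 = - (u^T *m H *m x) 0 0.
  by rewrite -mulmxA SKx mulmxN mulmxA [LHS]mxE.
rewrite qK opprK qP /stage_cost qformD// -!qformM.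
have -> : ((A *m x)^T *m Pc *m (B *m u)) 0 0 = (u^T *m H *m x) 0 0.
  have -> : (A *m x)^T *m Pc *m (B *m u) = (u^T *m H *m x)^T.
    by rewrite /H !trmx_mul !trmxK symP !mulmxA.
  by rewrite [LHS]mxE.
rewrite /S qform_add -qformM; ring.
Qed.

Definition noise_cost (w : 'cV[R]_q) := qform (G^T *m Pc *m G) w.

Lemma qform_next y w : qform Pc (y + G *m w) =
  qform Pc y + 2 * (y^T *m (Pc *m G) *m w) 0 0 + noise_cost w.
Proof.
have [symP _] := psdP.
by rewrite qformD// /noise_cost -qformM !mulmxA.
Qed.

Lemma noise_cost_ge0 w : 0 <= noise_cost w.
Proof. by rewrite /noise_cost -qformM; case: psdP. Qed.

Lemma stage_cost_ge0 x u : 0 <= stage_cost D x u.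
Proof.
have [_ R0] := pdmx_psd pdR; have [_ Q0] := psdQ.
by rewrite addr_ge0.
Qed.

Lemma horizon_cost_ge0 x (th : policy R m q N) w : 0 <= horizon_cost D x th w.
Proof.
have [_ P0] := psdP.
by rewrite addr_ge0// sumr_ge0// => k _; exact: stage_cost_ge0.
Qed.

Definition pred_deviation x (th : policy R m q N) w (k : 'I_N.+1) :=
  pred_input th w k - K *m pred_state D x th w k.

Definition pred_nominal x (th : policy R m q N) w (k : 'I_N.+1) :=
  A *m pred_state D x th w k + B *m pred_input th w k.

(** Telescoping of the completed squares along the predicted trajectory. *)
Lemma horizon_costE x (th : policy R m q N) w :
  horizon_cost D x th w = qform Pc x +
    \sum_k (qform S (pred_deviation x th w k) +
      (2 * ((pred_nominal x th w k)^T *m (Pc *m G) *m w k) 0 0 + noise_cost (w k))).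
Proof.
pose f k := qform Pc (pred_state D x th w k).
have H (k : 'I_N.+1) : stage_cost D (pred_state D x th w k) (pred_input th w k) =
   (f k - f k.+1) + (qform S (pred_deviation x th w k) +
      (2 * ((pred_nominal x th w k)^T *m (Pc *m G) *m w k) 0 0 + noise_cost (w k))).
  have := completion_of_squares (pred_state D x th w k) (pred_input th w k).
  rewrite /f pred_stateS qform_next -/(pred_nominal x th w k).
  rewrite /deviation -/(pred_deviation x th w k) => E.
  rewrite -[LHS](addrK (qform Pc (pred_nominal x th w k))) E; ring.
rewrite /horizon_cost; under eq_bigr do rewrite H.
rewrite big_split /= -(big_mkord xpredT (fun k => f k - f k.+1)).
rewrite (telescope_big (fun i j => f i - f j)) /=; last first.
  by move=> *; rewrite addrA subrK.
rewrite -[qform Pc (_ + G *m _)]/(f N.+1) -[qform Pc x]/(f 0%N); ring.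
Qed.

Section Expected.
Hypotheses (cW : closed W) (bW : bounded_set W).

Section OneLaw.
Variable P : probability (famRn R q 'I_N.+1) R.
Hypothesis indP : independent_coords P.
Hypothesis zmP : forall i, zero_mean_on W (marginal P i).

Let ae_W := ae_in_all cW zmP.

Lemma bounded_causal p i (f : ('I_N.+1 -> 'cV[R]_q) -> 'cV[R]_p) :
  causal_affine i f -> bounded_vec_on (in_all W) (f : famRn R q 'I_N.+1 -> _).
Proof.
move=> [c [C [_ fE]]]; rewrite (_ : f = fun w => c + \sum_j C j *m w j).
  apply: bounded_vecD; first exact: bounded_vec_cst.
  apply: bounded_vec_sum => j; apply: bounded_vecM; exact: bounded_coord.
by apply/funext => w; exact: fE.
Qed.

Lemma causal_deviation x th (k : 'I_N.+1) : causal_affine k (pred_deviation x th ^~ k).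
Proof.
apply: causalB; first exact: causal_pred_input.
by apply/causalM/causal_pred_state; exact: ltnW.
Qed.

Lemma causal_nominal x th (k : 'I_N.+1) : causal_affine k (pred_nominal x th ^~ k).
Proof.
apply: causalD; apply: causalM; last exact: causal_pred_input.
by apply: causal_pred_state; exact: ltnW.
Qed.

Lemma bounded_deviation x th k : bounded_on (in_all W)
  (fun w : famRn R q 'I_N.+1 => qform S (pred_deviation x th w k)).
Proof. by apply: bounded_qform; exact: (bounded_causal (causal_deviation x th k)). Qed.

Lemma bounded_noise k : bounded_on (in_all W)
  (fun w : famRn R q 'I_N.+1 => noise_cost (w k)).
Proof. by apply: bounded_qform; exact: bounded_coord. Qed.

Lemma bounded_horizon_cost x th : bounded_on (in_all W)
  (horizon_cost D x th : famRn R q 'I_N.+1 -> R).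
Proof.
have bs k : (k <= N.+1)%N -> bounded_vec_on (in_all W)
    (fun w : famRn R q 'I_N.+1 => pred_state D x th w k).
  by move=> /(causal_pred_state D x th)/bounded_causal.
have bi k : bounded_vec_on (in_all W)
    (fun w : famRn R q 'I_N.+1 => pred_input th w k).
  exact: (bounded_causal (causal_pred_input th k)).
apply: bounded_onD; last by apply: bounded_qform; exact: bs.
apply: bounded_on_sum => k; apply: bounded_onD; apply: bounded_qform; last exact: bi.
by apply: bs; exact: ltnW.
Qed.

(** All cross terms have mean zero, as the nominal prediction at time k involves
    only the disturbances before k. *)
Lemma expected_horizon_cost x th : Ex P (horizon_cost D x th) =
  qform Pc x + \sum_k Ex P (fun w => qform S (pred_deviation x th w k))
   + \sum_k Ex P (fun w => noise_cost (w k)).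
Proof.
rewrite (_ : horizon_cost D x th = fun w : famRn R q 'I_N.+1 => qform Pc x +
    \sum_k (qform S (pred_deviation x th w k) +
      (2 * ((pred_nominal x th w k)^T *m (Pc *m G) *m w k) 0 0 + noise_cost (w k)))).
  2: by apply/funext => w; exact: horizon_costE.
have bc k : bounded_on (in_all W) (fun w : famRn R q 'I_N.+1 =>
    ((pred_nominal x th w k)^T *m (Pc *m G) *m w k) 0 0).
  apply: bounded_form; last exact: bounded_coord.
  exact: (bounded_causal (causal_nominal x th k)).
have b2c k : bounded_on (in_all W) (fun w : famRn R q 'I_N.+1 =>
    2 * ((pred_nominal x th w k)^T *m (Pc *m G) *m w k) 0 0).
  by apply: bounded_onM => //; exact: bounded_on_cst.
have bd := bounded_deviation x th; have bn := bounded_noise.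
have b3 k := bounded_onD (b2c k) (bn k).
rewrite (ExD ae_W); [|exact: bounded_on_cst|].
  2: by apply: bounded_on_sum => k; exact: bounded_onD.
rewrite Ex_cst -addrA; congr (_ + _).
rewrite (Ex_sum ae_W); last by move=> k; exact: bounded_onD.
rewrite -big_split /=; apply: eq_bigr => k _.
rewrite (ExD ae_W)// (ExD ae_W)// (ExZ ae_W)//.
rewrite (Ex_cross0 cW bW indP zmP (k := k)) ?mulr0 ?add0r//.
  exact: (bounded_causal (causal_nominal x th k)).
by move=> w w0; apply: (causal_indep _ _ (causal_nominal x th k)).
Qed.

(** Feedback by the terminal gain has no deviations, while the first deviation of
    any policy is deterministic. *)
Lemma feedback_optimal x th thK :
  (forall w (i : 'I_N.+1), pred_input thK w i = K *m pred_state D x thK w i) ->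
  Ex P (horizon_cost D x thK) + deviation x (th.2 ord0) <=
  Ex P (horizon_cost D x th).
Proof.
move=> thKE; rewrite !expected_horizon_cost.
rewrite [X in _ + X + _ + _ <= _]big1 => [|k _]; last first.
  rewrite (_ : (fun _ => _) = fun=> 0) ?Ex_cst//.
  by apply/funext => w; rewrite /pred_deviation thKE subrr qform0.
rewrite addr0 addrAC lerD2r lerD2l big_ord_recl.
rewrite (_ : (fun w => _) = fun=> deviation x (th.2 ord0)); last first.
  by apply/funext => w; rewrite /pred_deviation pred_input0.
rewrite Ex_cst lerDl sumr_ge0// => k _.
apply: (Ex_ge0 ae_W) => [|w _]; first exact: bounded_deviation.
by have [_] := psd_input_weight; exact.
Qed.

End OneLaw.

Section Tail.
Variable P : probability (famRn R q 'I_N.+1) R.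
Hypothesis indP : independent_coords P.
Hypothesis zmP : forall i, zero_mean_on W (marginal P i).

(** A cyclic shift, because [relabel rotation] turns a family of independent
    disturbances into one that is delayed by a step and still independent, the
    last disturbance being reused as the first. *)
Definition rotation_fun (i : 'I_N.+1) : 'I_N.+1 :=
  if i == ord0 then ord_max else inord i.-1.

Lemma rotation_inj : injective rotation_fun.
Proof.
have H (i : 'I_N.+1) : i != ord0 -> (inord i.-1 : 'I_N.+1) = i.-1 :> nat.
  by move=> i0; rewrite inordK// (leq_ltn_trans (leq_pred _)).
have H' (i : 'I_N.+1) : i != ord0 -> (i.-1 < N)%N /\ i = i.-1.+1 :> nat.
  rewrite -(inj_eq val_inj) /= -lt0n => i0.
  by split; [rewrite -ltnS prednK|rewrite prednK].
move=> i j; rewrite /rotation_fun; case: eqP => [->|/eqP i0]; case: eqP => [->|/eqP j0]//.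
- move=> /(congr1 val) /=; rewrite H// => E; have [] := H' _ j0.
  by rewrite -E ltnn.
- move=> /(congr1 val) /=; rewrite H// => E; have [] := H' _ i0.
  by rewrite E ltnn.
- move=> /(congr1 val) /=; rewrite !H// => E; apply: val_inj => /=.
  by have [_ ->] := H' _ i0; have [_ ->] := H' _ j0; rewrite E.
Qed.

Definition rotation := perm rotation_inj.

Lemma relabel_rotation (w : famRn R q 'I_N.+1) :
  relabel rotation w = delay (w ord_max) w.
Proof.
apply/funext => i; rewrite /relabel permE /rotation_fun /delay.
by case: ifP.
Qed.

Lemma resample_delay (w0 w1 : 'cV[R]_q) (w : 'I_N.+1 -> 'cV[R]_q) :
  resample ord0 (delay w0 w, w1) = delay w1 w.
Proof. by apply/funext => i; rewrite /resample /delay /=; case: (i == ord0). Qed.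

(** The nominal tail, started without a first disturbance, is cheaper than the
    policy by the first stage cost.  Both expectations are taken with the same
    independent variables, used in cyclically shifted positions, so that the
    noise costs agree; averaging over the first disturbance only increases the
    deviations, by Jensen's inequality. *)
Lemma nominal_tail_cost x th th' : is_tail D x th 0 th' ->
  Ex P (horizon_cost D (next_state D x (th.2 ord0) 0) th') +
    stage_cost D x (th.2 ord0) <=
  Ex (relabeled P rotation) (horizon_cost D x th).
Proof.
move=> tl.
pose P' := relabeled P rotation.
have indP' : independent_coords P' by exact: relabeled_indep.
have zmP' i : zero_mean_on W (marginal P' i).
  exact: relabeled_zero_mean.
have ae_W := ae_in_all cW zmP; have ae_W' := ae_in_all cW zmP'.
rewrite (expected_horizon_cost indP zmP) (expected_horizon_cost indP' zmP').
have -> : \sum_k Ex P' (fun w => noise_cost (w k)) =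
    \sum_k Ex P (fun w => noise_cost (w k)).
  rewrite [RHS](reindex_inj (perm_inj (s := rotation))) /=.
  apply: eq_bigr => k _; rewrite Ex_distribution//.
    by have [] := bounded_noise k.
  apply: (bounded_integrable ae_W).
  exact: (bounded_noise (rotation k)).
rewrite addrAC lerD2r big_ord_recr /=.
rewrite [Ex P _ in X in _ + (_ + X) + _](_ : _ = 0) => [|]; last first.
  rewrite (_ : (fun _ => _) = fun=> 0) ?Ex_cst//; apply/funext => w.
  rewrite /pred_deviation; case: (tl) => _ ->; rewrite /tail_input ltnn tail_state//.
  by rewrite subrr qform0.
rewrite addr0 big_ord_recl /=.
rewrite (_ : Ex P' _ = deviation x (th.2 ord0)); last first.
  rewrite (_ : (fun w => _) = fun=> deviation x (th.2 ord0)) ?Ex_cst//.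
  by apply/funext => w; rewrite /pred_deviation pred_input0.
rewrite [leRHS]addrA -completion_of_squares /next_state mulmx0 addr0.
rewrite [leLHS]addrC [leLHS]addrA lerD2l.
apply: ler_sum => i _.
pose k : 'I_N.+1 := lift ord0 i.
have [L [_ Lk]] := causal_resample (causal_deviation x th k).
have J := Ex_qform_jensen cW bW indP' zmP' psd_input_weight
  (bounded_causal (causal_deviation x th k)) (Lk ord0).
apply: le_trans J.
rewrite Ex_distribution.
- rewrite le_eqVlt; apply/orP; left; apply/eqP; congr Ex; apply/funext => w /=.
  rewrite relabel_rotation resample_delay.
  congr (qform _ _); rewrite /pred_deviation.
  case: (tl) => _ ->; rewrite /tail_input /= ltn_ord.
  have iN : (i <= N)%N by exact: ltnW.
  have := tail_state w tl iN; rewrite /next_state mulmx0 addr0 /= => ->.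
  rewrite add0n (_ : inord i.+1 = k)//.
  by apply: val_inj; rewrite /= inordK// ltnS.
- have bdev := bounded_causal (causal_deviation x th k).
  have bL : bounded_vec_on (in_all W) (fun w : famRn R q 'I_N.+1 => L ord0 *m w ord0).
    by apply: bounded_vecM; exact: bounded_coord.
  apply: measurable_qform; apply: measurable_vec => // j.
  have [mj _] := bounded_vecB bdev bL j.
  rewrite (_ : (fun _ => _) = fun w : famRn R q 'I_N.+1 =>
    (pred_deviation x th w k - L ord0 *m w ord0) j 0)//.
  apply/funext => w; congr ((_ : 'cV[R]_m) j 0).
  have wE : resample ord0 (w, w ord0) = w.
    by apply/funext => i'; rewrite /resample /=; case: eqP => // ->.
  by have := Lk ord0 w (w ord0); rewrite wE => ->; rewrite addrK.
- apply: (bounded_integrable ae_W).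
  rewrite (_ : _ \o _ = fun w : famRn R q 'I_N.+1 => qform S (pred_deviation x th (delay 0 w) k)).
    apply: bounded_qform.
    exact: (bounded_causal (causal_delay 0 (causal_le (leqnSn _) (causal_deviation x th k)))).
  by apply/funext => w; rewrite /= relabel_rotation resample_delay.
Qed.

End Tail.
End Expected.
End Costs.

(** * The optimal control law *)

Section Controller.
Context {R : realType} {n m q N : nat}.
Variable D : mpc_data R n m q.
Local Notation A := (sysA D).
Local Notation B := (sysB D).
Local Notation G := (sysG D).
Local Notation K := (terminal_gain D).
Local Notation Qc := (costQ D).
Local Notation Rc := (costR D).
Local Notation Pc := (costP D).
Local Notation W := (disturbances D).
Local Notation X := (feasible_states N D).

Hypothesis psdQ : psdmx Qc.
Hypothesis pdR : pdmx Rc.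
Hypothesis psdP : psdmx Pc.
Hypothesis riccati : Pc = A^T *m Pc *m A
  - A^T *m Pc *m B *m invmx (Rc + B^T *m Pc *m B) *m B^T *m Pc *m A + Qc.
Hypotheses (cW : closed W) (bW : bounded_set W).
Hypothesis hterm : forall x w, terminal D x -> W w ->
  constraints D (x, K *m x) /\ terminal D ((A + B *m K) *m x + G *m w).

Lemma next_state_comb x u (w1 w2 : 'cV[R]_q) y v t :
  next_state D ((1 - t) *: x + t *: y) ((1 - t) *: u + t *: v)
    ((1 - t) *: w1 + t *: w2) =
  (1 - t) *: next_state D x u w1 + t *: next_state D y v w2.
Proof.
rewrite /next_state !mulmxDr -!scalemxAr.
by apply/matrixP => i j; rewrite !mxE; ring.
Qed.

Lemma stage_cost_convex x u y v t : 0 <= t <= 1 ->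
  stage_cost D ((1 - t) *: x + t *: y) ((1 - t) *: u + t *: v) <=
  (1 - t) * stage_cost D x u + t * stage_cost D y v.
Proof.
move=> t01; rewrite /stage_cost.
have := qform_convex x y psdQ t01; have := qform_convex u v (pdmx_psd pdR) t01.
lra.
Qed.

(** The predicted trajectory of the tail is affine in the disturbance that
    started it, so its cost is convex. *)
Lemma tail_cost_convex x (th : policy R m q N) w1 t th0 th1 tht w : 0 <= t <= 1 ->
  is_tail D x th 0 th0 -> is_tail D x th w1 th1 -> is_tail D x th (t *: w1) tht ->
  horizon_cost D (next_state D x (th.2 ord0) (t *: w1)) tht w <=
  (1 - t) * horizon_cost D (next_state D x (th.2 ord0) 0) th0 w +
  t * horizon_cost D (next_state D x (th.2 ord0) w1) th1 w.
Proof.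
move=> t01 tl0 tl1 tlt.
have delE : delay (t *: w1) w = (fun j => (1 - t) *: delay 0 w j + t *: delay w1 w j).
  apply/funext => i; rewrite /delay; case: ifP => _; first by rewrite scaler0 add0r.
  by rewrite -scalerDl subrK scale1r.
have inE k : pred_input tht w k =
    (1 - t) *: pred_input th0 w k + t *: pred_input th1 w k.
  case: tl0 tl1 tlt => [_ ->] [_ ->] [_ ->]; rewrite delE.
  exact: (causal_comb _ _ _ (causal_tail_input D x th k)).
have stE k : (k <= N)%N -> pred_state D (next_state D x (th.2 ord0) (t *: w1)) tht w k =
    (1 - t) *: pred_state D (next_state D x (th.2 ord0) 0) th0 w k +
    t *: pred_state D (next_state D x (th.2 ord0) w1) th1 w k.
  move=> kN; rewrite !tail_state// delE.
  by apply: (causal_comb _ _ _ (causal_pred_state D x th _)).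
have lastE : pred_state D (next_state D x (th.2 ord0) (t *: w1)) tht w N.+1 =
    (1 - t) *: pred_state D (next_state D x (th.2 ord0) 0) th0 w N.+1 +
    t *: pred_state D (next_state D x (th.2 ord0) w1) th1 w N.+1.
  rewrite -[N.+1]/((@ord_max N).+1) !pred_stateS stE// inE.
  rewrite -!/(next_state D _ _ _) -next_state_comb; congr next_state.
  by rewrite -scalerDl subrK scale1r.
rewrite /horizon_cost lastE !mulrDr addrACA lerD//; last exact: qform_convex.
rewrite !mulr_sumr -big_split /=; apply: ler_sum => k _.
by rewrite stE -1?ltnS// inE; exact: stage_cost_convex.
Qed.

Section Law.
Variable d : R * 'M[R]_q.
Hypothesis admd : admissible W d.

Lemma ambiguity_zm (P : probability (famRn R q 'I_N.+1) R) :
  ambiguity_product W d P -> forall i, zero_mean_on W (marginal P i).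
Proof. by move=> [_ H] i; case: (H i). Qed.

Lemma worst_cost_ge (P : probability (famRn R q 'I_N.+1) R) x th :
  ambiguity_product W d P ->
  ((Ex P (horizon_cost D x th))%:E <= worst_cost D d x th)%E.
Proof.
move=> aP; apply: ereal_sup_ubound; exists P => //.
apply: (expectationE (ae_in_all cW (ambiguity_zm aP))).
exact: bounded_horizon_cost.
Qed.

Lemma worst_cost_le x (th : policy R m q N) (c : \bar R) :
  (forall P : probability (famRn R q 'I_N.+1) R, ambiguity_product W d P ->
     ((Ex P (horizon_cost D x th))%:E <= c)%E) ->
  (worst_cost D d x th <= c)%E.
Proof.
move=> H; apply: ub_ereal_sup => _ [P aP <-].
rewrite (expectationE (ae_in_all cW (ambiguity_zm aP))); first exact: H.
exact: bounded_horizon_cost.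
Qed.

Lemma worst_cost_ge0 x (th : policy R m q N) : (0 <= worst_cost D d x th)%E.
Proof.
have [P aP] := ambiguity_product_ex N cW admd.
apply: le_trans (worst_cost_ge x th aP); rewrite lee_fin.
apply: (Ex_ge0 (ae_in_all cW (ambiguity_zm aP))); first exact: bounded_horizon_cost.
by move=> w _; exact: horizon_cost_ge0.
Qed.

Lemma worst_cost_bound x (th : policy R m q N) M :
  (forall w, (forall k, W (w k)) -> horizon_cost D x th w <= M) ->
  (worst_cost D d x th <= M%:E)%E.
Proof.
move=> H; apply: worst_cost_le => P aP; rewrite lee_fin.
have ae_W := ae_in_all cW (ambiguity_zm aP).
rewrite -[leRHS](Ex_cst P) (Ex_le ae_W)//.
  exact: bounded_horizon_cost.
exact: bounded_on_cst.
Qed.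

(** Disturbances being bounded, so are the costs of each policy; finite values
    allow subtraction of worst cases. *)
Lemma worst_cost_fin x (th : policy R m q N) : worst_cost D d x th \is a fin_num.
Proof.
rewrite ge0_fin_numE ?worst_cost_ge0//.
have [_ [M MJ]] := bounded_horizon_cost bW x th.
apply: (@le_lt_trans _ _ M%:E); last exact: ltry.
by apply: worst_cost_bound => w Ww; exact: le_trans (ler_norm _) (MJ w Ww).
Qed.

(** On the terminal set the terminal gain is feasible, and by the completion of
    squares it is the only optimal first input. *)
Lemma terminal_optimal x th : terminal D x -> optimal_policies (N := N) D d x th ->
  th.2 ord0 = K *m x.
Proof.
move=> Xx [_ opt].
have [thK [cthK thKE]] := @feedback_policy R n m q N D x.
have optK := opt _ (feasible_feedback hterm Xx cthK thKE).
have pdS := pd_input_weight pdR psdP.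
apply/eqP; rewrite -subr_eq0; apply/eqP; apply: (pdmx_eq0 pdS).
rewrite -/(deviation D x (th.2 ord0)); set dev := deviation _ _ _.
have := worst_cost_fin x thK; set v := worst_cost D d x thK in optK * => vfin.
have : (v <= v - dev%:E)%E.
  apply: worst_cost_le => P aP; rewrite leeBrDr// -EFinD.
  apply: le_trans optK; apply: le_trans (worst_cost_ge x th aP); rewrite lee_fin.
  have [indP _] := aP.
  exact: (feedback_optimal pdR psdP riccati cW bW indP (ambiguity_zm aP)).
rewrite -(fineK vfin) -EFinB lee_fin => H; lra.
Qed.

Definition value x : \bar R :=
  ereal_inf [set worst_cost D d x th | th in feasible_policies (N := N) D x].

Lemma value_optimal x th : optimal_policies (N := N) D d x th -> value x = worst_cost D d x th.
Proof.
move=> [F opt]; apply/eqP; rewrite eq_le; apply/andP; split.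
  by apply: ereal_inf_lbound; exists th.
by apply: le_ereal_inf_tmp => _ [th' F' <-]; exact: opt.
Qed.

Lemma value_ge0 x : (0 <= value x)%E.
Proof. by apply: le_ereal_inf_tmp => _ [th F <-]; exact: worst_cost_ge0. Qed.

Lemma terminal_feasible x : terminal D x -> X x.
Proof.
move=> Xx; have [thK [cthK thKE]] := @feedback_policy R n m q N D x.
by exists thK; exact: (feasible_feedback hterm Xx cthK thKE).
Qed.

(** The value decreases along the undisturbed system, and by convexity it
    increases little more under a disturbance that is a small multiple of a
    possible one. *)
Lemma value_descent x th M w1 t : optimal_policies (N := N) D d x th ->
  (forall y th' w, X y -> feasible_policies (N := N) D y th' ->
     (forall k, W (w k)) -> horizon_cost D y th' w <= M) ->
  W w1 -> 0 <= t <= 1 -> W (t *: w1) ->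
  (value (next_state D x (th.2 ord0) (t *: w1)) + (stage_cost D x (th.2 ord0))%:E
    <= value x + (t * M)%:E)%E.
Proof.
move=> opt MJ Ww1 t01 Wt; have [F _] := opt.
have [th0 tl0] := tail_policy D x th 0.
have [th1 tl1] := tail_policy D x th w1.
have [tht tlt] := tail_policy D x th (t *: w1).
have F1 := feasible_tail hterm F Ww1 tl1.
have Ft := feasible_tail hterm F Wt tlt.
rewrite (value_optimal opt) -leeBrDr//.
apply: (@le_trans _ _ (worst_cost D d (next_state D x (th.2 ord0) (t *: w1)) tht)).
  by apply: ereal_inf_lbound; exists tht.
apply: worst_cost_le => P aP; rewrite leeBrDr// -EFinD.
have [indP _] := aP; have zmP := ambiguity_zm aP; have ae_W := ae_in_all cW zmP.
set J0 := horizon_cost D (next_state D x (th.2 ord0) 0) th0 : famRn R q 'I_N.+1 -> R.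
have bJ y th' := @bounded_horizon_cost R n m q N D bW y th'.
have H1 : Ex P (horizon_cost D (next_state D x (th.2 ord0) (t *: w1)) tht) <=
    Ex P J0 + t * M.
  have bM : bounded_on (in_all W) (fun _ : famRn R q 'I_N.+1 => t * M).
    exact: bounded_on_cst.
  rewrite -[in leRHS](Ex_cst P (t * M)) -(ExD ae_W)//; last exact: bJ.
  apply: (Ex_le ae_W); [exact: bJ|by apply: bounded_onD => //; exact: bJ|].
  move=> w Ww; apply: (le_trans (tail_cost_convex w t01 tl0 tl1 tlt)).
  have J1 : horizon_cost D (next_state D x (th.2 ord0) w1) th1 w <= M.
    by apply: MJ => //; exists th1.
  have J0p : 0 <= J0 w by exact: horizon_cost_ge0.
  rewrite lerD//; last by rewrite ler_wpM2l//; case/andP: t01.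
  by rewrite mulrBl mul1r lerBlDr lerDl mulr_ge0//; case/andP: t01.
have H2 := nominal_tail_cost pdR psdP riccati cW bW indP zmP tl0.
apply: (@le_trans _ _ ((Ex (relabeled P (@rotation N)) (horizon_cost D x th)) + t * M)%:E).
  rewrite lee_fin; apply: (le_trans (lerD H1 (lexx _))).
  by rewrite addrAC lerD2r; exact: H2.
rewrite EFinD leeD2r//; apply: worst_cost_ge; exact: relabeled_ambiguity.
Qed.

End Law.

(** Inputs stay bounded along feasible predictions, so bounds on the predicted
    states propagate from the bounded initial states. *)
Lemma horizon_cost_bound : bounded_set X -> bounded_set (inputs D) ->
  (forall x u, constraints D (x, u) -> inputs D u) ->
  exists2 M, 0 <= M & forall x th w, X x -> feasible_policies (N := N) D x th ->
    (forall k, W (w k)) -> horizon_cost D x th w <= M.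
Proof.
move=> bX bU ZU.
have [Mx Mx0 MX] := bounded_set_bound bX.
have [Mu Mu0 MU] := bounded_set_bound bU.
have [Mw Mw0 MW] := bounded_set_bound bW.
have H k : exists b, (k <= N.+1)%N -> forall x th w, X x ->
    feasible_policies (N := N) D x th ->
    (forall k, W (w k)) -> `|pred_state D x th w k| <= b.
  elim: k => [|k [b IH]]; first by exists Mx => _ x th w Xx _ _; exact: MX.
  exists (n%:R * `|A| * b + m%:R * `|B| * Mu + q%:R * `|G| * Mw) => kN x th w Xx F Ww /=.
  rewrite (le_trans (ler_normD _ _))// lerD//; last first.
    by rewrite (le_trans (mulmx_norm_le _ _))// ler_wpM2l ?mulr_ge0// MW.
  rewrite (le_trans (ler_normD _ _))// lerD//.
    by rewrite (le_trans (mulmx_norm_le _ _))// ler_wpM2l ?mulr_ge0// IH// ltnW.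
  rewrite (le_trans (mulmx_norm_le _ _))// ler_wpM2l ?mulr_ge0// MU//.
  by have [_ /(_ _ Ww)[H _]] := F; exact: ZU (H (inord k)).
have [b bP] := choice H.
pose c p (S : 'M[R]_p) := p%:R * (p%:R * `|S|).
have c0 p (S : 'M[R]_p) : 0 <= c p S by rewrite !mulr_ge0.
have qb p (S : 'M[R]_p) y r : `|y| <= r -> qform S y <= c p S * r ^+ 2.
  move=> yr; rewrite (le_trans (ler_norm _))// (le_trans (qform_le_norm _ _))//.
  rewrite ler_wpM2l//; rewrite -/(c p S)//.
  by rewrite ler_sqr ?nnegrE// (le_trans _ yr).
exists (\sum_(k < N.+1) (c n Qc * b k ^+ 2 + c m Rc * Mu ^+ 2) + c n Pc * b N.+1 ^+ 2).
  apply: addr_ge0; last by rewrite mulr_ge0// sqr_ge0.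
  by apply: sumr_ge0 => k _; rewrite addr_ge0// mulr_ge0// sqr_ge0.
move=> x th w Xx F Ww; rewrite /horizon_cost lerD//; last by apply: qb; exact: bP.
apply: ler_sum => k _; rewrite /stage_cost lerD//; apply: qb.
  by apply: bP => //; exact: ltnW.
by apply: MU; have [_ /(_ _ Ww)[H' _]] := F; exact: ZU (H' k).
Qed.

End Controller.

(** * Closedness of the feasible set *)

Section MatrixLimits.
Context {R : realType} {T : Type} (F : set_system T).

Lemma cvg_mx {FF : Filter F} m n (f : T -> 'M[R]_(m, n)) (l : 'M[R]_(m, n)) :
  (forall i j, f t i j @[t --> F] --> l i j) -> f t @[t --> F] --> l.
Proof.
move=> H; apply/cvg_ballP => e e0.
have : \forall t \near F, forall ij : 'I_m * 'I_n, ball (l ij.1 ij.2) e (f t ij.1 ij.2).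
  by apply: filter_forall => -[i j] /=; move/cvg_ballP : (H i j); exact.
by apply: filterS => t Ht; split=> // i j; exact: (Ht (i, j)).
Qed.

Lemma cvg_mulmx {FF : Filter F} m n p (f : T -> 'M[R]_(m, n)) (g : T -> 'M[R]_(n, p))
    (a : 'M[R]_(m, n)) (b : 'M[R]_(n, p)) :
  f t @[t --> F] --> a -> g t @[t --> F] --> b ->
  f t *m g t @[t --> F] --> a *m b.
Proof.
move=> fa gb; apply: cvg_mx => i j; rewrite mxE.
rewrite (_ : (fun _ => _) = fun t => \sum_k f t i k * g t k j); last first.
  by apply/funext => t; rewrite mxE.
apply: cvg_big => [|k _]; first by move=> x; exact: add_continuous.
apply: cvgM.
- exact: (cvg_comp _ _ fa (@coord_continuous R m n i k a)).
- exact: (cvg_comp _ _ gb (@coord_continuous R n p k j b)).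
Qed.

Lemma ultra_bounded_lim {UF : UltraFilter F} m n (f : T -> 'M[R]_(m, n)) C :
  (\forall t \near F, `|f t| <= C) -> exists l : 'M[R]_(m, n), f t @[t --> F] --> l.
Proof.
move=> fC.
have H i j : exists l : R, f t i j @[t --> F] --> l.
  have [|l [_ cl]] := @segment_compact R (- C) C ((fun t => f t i j) @ F).
    apply: filterS fC => t ftC /=; rewrite in_itv /= -ler_norml.
    exact: le_trans (mx_norm_entry _ _ _) ftC.
  exists l => V Vl.
  have [//|FV] := in_ultra_setVsetC ((fun t => f t i j) @^-1` V) UF.
  by have [z []] := cl (~` V) V FV Vl.
have /choice[l lP] i : exists li : 'I_n -> R, forall j, f t i j @[t --> F] --> li j.
  by have [li liP] := choice (H i); exists li.
exists (\matrix_(i, j) l i j); apply: cvg_mx => i j; rewrite mxE; exact: lP.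
Qed.

End MatrixLimits.

Section FeasibleClosed.
Context {R : realType} {n m q N : nat}.
Variable D : mpc_data R n m q.
Local Notation A := (sysA D).
Local Notation B := (sysB D).
Local Notation G := (sysG D).
Local Notation W := (disturbances D).

Hypotheses (cZ : closed (constraints D)) (cXf : closed (terminal D)).
Hypothesis bU : bounded_set (inputs D).
Hypothesis ZU : forall x u, constraints D (x, u) -> inputs D u.
Hypothesis W_int : (W°)%classic 0.

Lemma disturbance_ball : exists2 r : R, 0 < r & forall w : 'cV[R]_q, `|w| <= r -> W w.
Proof.
have : nbhs (0 : 'cV[R]_q) W by exact: W_int.
move=> /nbhs_normP[e /= e0 eW]; exists (e / 2); first by rewrite divr_gt0.
move=> w wr; apply: eW; rewrite /ball_ /= sub0r normrN.
by rewrite (le_lt_trans wr)// ltr_pdivrMr// ltr_pMr// ltrDl.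
Qed.

(** The input at the zero disturbances bounds the constant part; as disturbances
    fill a ball, a single one along an axis then bounds each column of a block. *)
Lemma feasible_policies_bounded : exists C, forall x (th : policy R m q N),
  feasible_policies D x th ->
  (forall i j, `|th.1 i j| <= C) /\ (forall i, `|th.2 i| <= C).
Proof.
have [Mu Mu0 MU] := bounded_set_bound bU.
have [r r0 rW] := disturbance_ball.
have Win (w : 'I_N.+1 -> 'cV[R]_q) x th i : (forall k, `|w k| <= r) ->
    feasible_policies D x th -> `|pred_input th w i| <= Mu.
  move=> wr [_ F]; apply: MU.
  by have [/(_ i)/ZU + _] := F w (fun k => rW _ (wr k)).
exists (Mu + (2 * Mu) / r) => x th F.
have H2 i : `|th.2 i| <= Mu.
  have := @Win (fun=> 0) x th i; rewrite /pred_input big1 ?addr0; last first.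
    by move=> j _; rewrite mulmx0.
  by apply=> // k; rewrite normr0 ltW.
split=> [i j|i]; last by rewrite (le_trans (H2 i))// lerDl divr_ge0 ?mulr_ge0// ltW.
have [ij|ji] := leqP i j.
  by case: F => -> // _; rewrite normr0 addr_ge0// divr_ge0 ?mulr_ge0// ltW.
apply: (@le_trans _ _ (2 * Mu / r)); last by rewrite lerDr.
have M0 : 0 <= 2 * Mu / r by rewrite divr_ge0 ?mulr_ge0// ltW.
apply: mx_norm_le => // a b.
pose w k := if k == j then r *: delta_mx b 0 else 0 : 'cV[R]_q.
have wr k : `|w k| <= r.
  rewrite /w; case: ifP => _; last by rewrite normr0 ltW.
  rewrite normrZ gtr0_norm// ler_piMr ?(ltW r0)//.
  by apply: mx_norm_le => // a' b'; rewrite mxE; case: (_ && _); rewrite ?normr1 ?normr0.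
have := Win w x th i wr F.
rewrite /pred_input (bigD1 j)//= big1 ?addr0; last first.
  by move=> k /andP[_ /negPf kj]; rewrite /w kj mulmx0.
rewrite /w eqxx -scalemxAr => H.
have : `|r *: (th.1 i j *m delta_mx b (0 : 'I_1))| <= 2 * Mu.
  rewrite -[X in `|X|](addKr (th.2 i)) mulr_natl mulr2n.
  by rewrite (le_trans (ler_normD _ _))// normrN lerD.
rewrite normrZ gtr0_norm// -ler_pdivlMl// mulrC => H'.
apply: le_trans H'; rewrite -colE.
by have := mx_norm_entry (col b (th.1 i j)) a 0; rewrite mxE.
Qed.

(** Near a limit of feasible states an ultrafilter selects convergent
    policies, and the constraints pass to the limit. *)
Lemma feasible_states_closed : closed (feasible_states N D).
Proof.
move=> x clx; set X := feasible_states N D in clx *.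
have XF : ProperFilter (within X (nbhs x)) by exact: within_nbhs_proper.
have [F [UF wF]] := ultraFilterLemma XF.
have FX : F X by apply: wF; rewrite /within /=; exact: filterE.
have cvx : y @[y --> F] --> x.
  by move=> V Vx; apply: wF; rewrite /within /=; apply: filterS Vx.
pose th0 : policy R m q N := (fun _ _ => 0, fun=> 0).
pose th y := xget th0 (feasible_policies (N := N) D y).
have thF y : X y -> feasible_policies D y (th y) by move=> Xy; exact: xgetPex.
have [C thC] := feasible_policies_bounded.
have [M MP] : exists M : 'I_N.+1 -> 'I_N.+1 -> 'M[R]_(m, q),
    forall i j, (th y).1 i j @[y --> F] --> M i j.
  have H i j : exists l : 'M[R]_(m, q), (th y).1 i j @[y --> F] --> l.
    apply: (@ultra_bounded_lim _ _ _ _ _ _ _ C).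
    by apply: filterS FX => y /thF /thC [+ _]; exact.
  have /choice[M MP] i : exists Mi : 'I_N.+1 -> 'M[R]_(m, q),
      forall j, (th y).1 i j @[y --> F] --> Mi j.
    by have [Mi MiP] := choice (H i); exists Mi.
  by exists M.
have /choice[v vP] i : exists vi : 'cV[R]_m, (th y).2 i @[y --> F] --> vi.
  apply: (@ultra_bounded_lim _ _ _ _ _ _ _ C).
  by apply: filterS FX => y /thF /thC [_]; exact.
pose thl : policy R m q N := (M, v).
have cvu w i : pred_input (th y) w i @[y --> F] --> pred_input thl w i.
  apply: cvgD; first exact: vP.
  apply: cvg_big => [|j _]; first by move=> z; exact: add_continuous.
  apply: cvg_mulmx; first exact: MP.
  exact: cvg_cst.
have cvs w k : pred_state D y (th y) w k @[y --> F] --> pred_state D x thl w k.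
  elim: k => [|k IH] /=; first exact: cvx.
  apply: cvgD; last exact: cvg_cst.
  apply: cvgD; apply: cvg_mulmx; [exact: cvg_cst|exact: IH|exact: cvg_cst|exact: cvu].
exists thl; split.
  move=> i j ij.
  have : (th y).1 i j @[y --> F] --> (0 : 'M[R]_(m, q)).
    apply: cvg_trans (cvg_cst (0 : 'M[R]_(m, q))).
    apply: near_eq_cvg; apply: filterS FX => y /thF [cy _].
      by rewrite cy.
    exact: filter_filter.
  by move=> /(cvg_unique _ (MP i j)); exact.
move=> w Ww; split=> [k|].
  apply: (@closed_cvg _ _ F _
    (fun y => (pred_state D y (th y) w k, pred_input (th y) w k)) _ cZ).
    by apply: filterS FX => y /thF [_ /(_ w Ww) [H _]]; exact: H.
  exact: (cvg_pair (cvs w k) (cvu w k)).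
apply: (@closed_cvg _ _ F _ (fun y => pred_state D y (th y) w N.+1) _ cXf).
  by apply: filterS FX => y /thF [_ /(_ w Ww) []].
exact: cvs.
Qed.

End FeasibleClosed.

(** * Markov chains driven by independent disturbances *)

Lemma ae_sub d (T : measurableType d) (R : realType)
    (mu : {measure set T -> \bar R}) (A B : set T) : A `<=` B ->
  {ae mu, forall t, A t} -> {ae mu, forall t, B t}.
Proof.
move=> AB [C [mC C0 sC]]; exists C; split=> // t nBt.
by apply: sC => /AB.
Qed.

Section Chain.
Context {R : realType} {n q : nat}.
Variables (f : 'cV[R]_n -> 'cV[R]_n) (G : 'M[R]_(n, q)).
Hypothesis mf : measurable_fun setT (f : borelRn R n -> borelRn R n).

Definition step (x : 'cV[R]_n) (w : 'cV[R]_q) : 'cV[R]_n := f x + G *m w.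

Fixpoint trajectory (x : 'cV[R]_n) (w : nat -> 'cV[R]_q) (k : nat) : 'cV[R]_n :=
  if k is j.+1 then step (trajectory x w j) (w j) else x.

Lemma measurable_trajectory x k :
  measurable_fun setT (fun w : famRn R q nat => trajectory x w k : borelRn R n).
Proof.
elim: k => [|k IH] /=; first exact: measurable_cst.
apply: measurable_vecD; first exact: (measurableT_comp mf IH).
by apply: measurable_vecM; exact: measurable_coord.
Qed.

Lemma trajectory_resample x w (w0 : 'cV[R]_q) j k : (j <= k)%N ->
  trajectory x (resample k (w, w0)) j = trajectory x w j.
Proof.
elim: j => [//|j IH] jk /=; rewrite IH 1?ltnW//.
by rewrite /resample ltn_eqF.
Qed.

Variable rho : probability (borelRn R q) R.

Lemma measurable_step :
  measurable_fun setT (fun p : borelRn R n * borelRn R q =>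
    step p.1 p.2 : borelRn R n).
Proof.
apply: measurable_vecD; first exact: (measurableT_comp mf measurable_fst).
by apply: measurable_vecM; exact: measurable_snd.
Qed.

Definition transition (h : borelRn R n -> \bar R) (x : borelRn R n) : \bar R :=
  (\int[rho]_w h (step x w))%E.

Lemma transition_ge0 (h : borelRn R n -> \bar R) : (forall x, 0 <= h x)%E -> (forall x, 0 <= transition h x)%E.
Proof. by move=> h0 x; exact: integral_ge0. Qed.

Lemma measurable_transition (h : borelRn R n -> \bar R) : measurable_fun setT h -> (forall x, 0 <= h x)%E ->
  measurable_fun setT (transition h).
Proof.
move=> mh h0.
apply: (measurable_fun_fubini_tonelli_F (fun p : borelRn R n * borelRn R q =>
  h (step p.1 p.2))) => //.
exact: (measurableT_comp mh measurable_step).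
Qed.

Lemma iter_transition_ge0 (h : borelRn R n -> \bar R) k : (forall x, 0 <= h x)%E ->
  forall x, (0 <= iter k transition h x)%E.
Proof. by move=> h0; elim: k => // k IH x; exact: transition_ge0. Qed.

Lemma measurable_iter_transition (h : borelRn R n -> \bar R) k : measurable_fun setT h ->
  (forall x, 0 <= h x)%E -> measurable_fun setT (iter k transition h).
Proof.
move=> mh h0; elim: k => //= k IH.
by apply: measurable_transition => // x; exact: iter_transition_ge0.
Qed.

Lemma measurable_section (h : borelRn R n -> \bar R) x : measurable_fun setT h ->
  measurable_fun setT (fun w : borelRn R q => h (step x w)).
Proof.
move=> mh; apply: (measurableT_comp mh); apply: measurable_vecD.
  exact: measurable_cst.
by apply: measurable_vecM; exact: measurable_id.
Qed.

(** The Markov property: the last disturbance is independent of the state that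
    it meets, so it can be integrated first. *)
Lemma expectation_trajectory P (h : borelRn R n -> \bar R) x k : independent_coords P ->
  (forall i A, measurable A -> marginal P i A = rho A) ->
  measurable_fun setT h -> (forall x, 0 <= h x)%E ->
  (\int[P]_w h (trajectory x w k) = iter k transition h x)%E.
Proof.
move=> indP mP; elim: k h => [|k IH] h mh h0.
  rewrite -[LHS]/(\int[P]_w cst (h x) w)%E integral_cst//=.
  rewrite [X in (_ * X)%E](@probability_setT _ _ _ P).
  by rewrite mule1.
rewrite (ge0_integral_resample (rho := rho) (k := k) indP)//=; first last.
- apply: (measurableT_comp mh); exact: (measurable_trajectory x k.+1).
- exact: mP.
under eq_integral => w _.
  under eq_integral => w0 _ do rewrite trajectory_resample// /resample eqxx /=.
  rewrite -/(transition h (trajectory x w k)).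
  over.
rewrite IH -?iterSr//.
  exact: measurable_transition.
exact: transition_ge0.
Qed.

Section Invariant.
Variables (W : set 'cV[R]_q) (X : set 'cV[R]_n).
Hypothesis cW : closed W.
Hypothesis rhoW : rho W = 1%E.
Hypothesis X_inv : forall x w, X x -> W w -> X (step x w).

Lemma ae_W : {ae rho, forall w, W w}.
Proof.
exists (~` W); split=> //.
  by apply: measurableC; exact: closed_borel.
rewrite probability_setC; last exact: closed_borel.
rewrite [X in (_ - X)%E]rhoW; exact: subee.
Qed.

Lemma transition_le (h h' : borelRn R n -> \bar R) x : measurable_fun setT h -> (forall x, 0 <= h x)%E ->
  measurable_fun setT h' -> (forall x, 0 <= h' x)%E ->
  (forall x, X x -> (h x <= h' x)%E) -> X x -> (transition h x <= transition h' x)%E.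
Proof.
move=> mh h0 mh' h0' hh' Xx; apply: ae_ge0_le_integral => //.
- exact: measurable_section.
- exact: measurable_section.
- by apply: ae_sub ae_W => w Ww _; apply: hh'; exact: X_inv.
Qed.

Lemma iter_transition_le (h h' : borelRn R n -> \bar R) k x :
  measurable_fun setT h -> (forall x, 0 <= h x)%E ->
  measurable_fun setT h' -> (forall x, 0 <= h' x)%E ->
  (forall x, X x -> (h x <= h' x)%E) -> X x ->
  (iter k transition h x <= iter k transition h' x)%E.
Proof.
move=> mh h0 mh' h0' hh'; elim: k x => [|k IH] x Xx /=; first exact: hh'.
apply: transition_le => //.
- exact: measurable_iter_transition.
- by move=> y; exact: iter_transition_ge0.
- exact: measurable_iter_transition.
- by move=> y; exact: iter_transition_ge0.
Qed.

Lemma iter_transitionD (h h' : borelRn R n -> \bar R) k x :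
  measurable_fun setT h -> (forall x, 0 <= h x)%E ->
  measurable_fun setT h' -> (forall x, 0 <= h' x)%E ->
  (iter k transition (fun y => h y + h' y) x =
   iter k transition h x + iter k transition h' x)%E.
Proof.
move=> mh h0 mh' h0'; elim: k x => [//|k IH] x /=.
rewrite [LHS](_ : _ = transition (fun y => iter k transition h y + iter k transition h' y)%E x).
  apply: ge0_integralD => //.
  - by move=> w _; exact: iter_transition_ge0.
  - by apply: measurable_section; exact: measurable_iter_transition.
  - by move=> w _; exact: iter_transition_ge0.
  - by apply: measurable_section; exact: measurable_iter_transition.
by apply: eq_integral => w _; exact: IH.
Qed.

Lemma iter_transitionZ (h : borelRn R n -> \bar R) k (c : R) x :
  measurable_fun setT h -> (forall x, 0 <= h x)%E -> 0 <= c ->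
  (iter k transition (fun y => c%:E * h y) x = c%:E * iter k transition h x)%E.
Proof.
move=> mh h0 c0; elim: k x => [//|k IH] x /=.
rewrite [LHS](_ : _ = transition (fun y => c%:E * iter k transition h y)%E x).
  apply: ge0_integralZl_EFin => //.
  - by move=> w _; exact: iter_transition_ge0.
  - by apply: measurable_section; exact: measurable_iter_transition.
by apply: eq_integral => w _; exact: IH.
Qed.

Lemma iter_transition_cst (c : R) k x :
  (iter k transition (fun=> c%:E) x = c%:E)%E.
Proof.
elim: k x => [//|k IH] x /=.
rewrite [LHS](_ : _ = transition (fun=> c%:E) x).
  rewrite /transition integral_cst//= [X in (_ * X)%E](@probability_setT _ _ _ rho).
  by rewrite mule1.
by apply: eq_integral => w _; exact: IH.
Qed.

Section Hitting.
Variables (Xf : set 'cV[R]_n) (v : 'cV[R]_n -> \bar R) (small : set (borelRn R q)).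
Variables (eta : R).
Hypothesis cXf : closed Xf.
Hypothesis Xf_inv : forall x w, Xf x -> W w -> Xf (step x w).
Hypothesis msmall : measurable small.
Hypothesis v_ge0 : forall x, (0 <= v x)%E.
Hypothesis v_descent : forall x w, X x -> ~ Xf x -> W w -> small w ->
  (v (step x w) + eta%:E <= v x)%E.

Definition outside (x : borelRn R n) : \bar R := (\1_(~` Xf) x)%:E.

Lemma measurable_outside : measurable_fun setT outside.
Proof.
apply/measurable_EFinP; apply: measurable_indic; apply: measurableC.
exact: closed_borel.
Qed.

Lemma outside_ge0 x : (0 <= outside x)%E.
Proof. by rewrite lee_fin indicE. Qed.

Lemma outside_le1 x : (outside x <= 1)%E.
Proof. by rewrite lee_fin indicE lern1; case: (_ \in _). Qed.

Let mo := measurable_outside.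
Let o0 := outside_ge0.

Lemma iter_outside_le1 k x : X x -> (iter k transition outside x <= 1)%E.
Proof.
move=> Xx; rewrite -[leRHS](iter_transition_cst 1 k x).
by apply: iter_transition_le => // y _; exact: outside_le1.
Qed.

Lemma iter_outside_terminal k x : Xf x -> iter k transition outside x = 0%E.
Proof.
move=> Xfx; elim: k x Xfx => [|k IH] x Xfx /=.
  by rewrite /outside indicE memNset.
rewrite /transition (ae_eq_integral (cst 0%E)) ?integral0//.
  by apply: measurable_section; exact: measurable_iter_transition.
by apply: ae_sub ae_W => w Ww _; apply: IH; exact: Xf_inv.
Qed.

Let p := fine (rho small).

(** By induction on the level [j] of the value: either the terminal set is
    reached, where the chain stays, or a small disturbance, of probability [p],
    lowers the level by one. *)
Lemma hitting_probability j x : X x -> (v x < (j%:R * eta)%:E)%E ->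
  (iter j transition outside x <= (1 - p ^+ j)%:E)%E.
Proof.
have pE : rho small = p%:E by rewrite fineK// fin_num_measure.
have p0 : 0 <= p by rewrite fine_ge0.
have p1 : p <= 1 by rewrite -lee_fin -pE probability_le1.
elim: j x => [|j IH] x Xx vx.
  by move: vx; rewrite mul0r ltNge v_ge0.
have pj0 : 0 <= p ^+ j by rewrite exprn_ge0.
have pj1 : p ^+ j <= 1 by rewrite exprn_ile1.
have [Xfx|nXfx] := pselect (Xf x).
  rewrite iter_outside_terminal// lee_fin subr_ge0 exprS.
  by rewrite mulr_ile1.
(* The bound for the conditional probability given the first disturbance. *)
pose b (w : borelRn R q) : \bar R :=
  ((1 - p ^+ j)%:E * (\1_small w)%:E + (\1_(~` small) w)%:E)%E.
have mi A : measurable A -> measurable_fun setT (fun w : borelRn R q => (\1_A w : R)%:E).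
  by move=> mA; apply/measurable_EFinP; exact: measurable_indic.
have msC : measurable (~` small) by exact: measurableC.
have mb1 : measurable_fun setT (fun w : borelRn R q => (1 - p ^+ j)%:E * (\1_small w)%:E)%E.
  by apply: measurable_funeM; exact: mi.
have q0 : 0 <= 1 - p ^+ j by rewrite subr_ge0.
have b10 w : (0 <= (1 - p ^+ j)%:E * (\1_small w : R)%:E)%E.
  by rewrite mule_ge0 ?lee_fin// indicE.
have b20 w : (0 <= (\1_(~` small) w : R)%:E)%E by rewrite lee_fin indicE.
have mb : measurable_fun setT b by apply: emeasurable_funD => //; exact: mi.
have intb : (\int[rho]_w b w = (1 - p ^+ j.+1)%:E)%E.
  have i1 : (\int[rho]_w (\1_small w : R)%:E = p%:E)%E.
    by rewrite integral_indic// setIT.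
  have i2 : (\int[rho]_w (\1_(~` small) w : R)%:E = (1 - p)%:E)%E.
    rewrite integral_indic// setIT; apply: (eq_trans (probability_setC _ msmall)).
    by rewrite [X in (_ - X)%E]pE.
  rewrite ge0_integralD//; last exact: mi.
  rewrite ge0_integralZl_EFin//; last exact: mi.
  rewrite i1 i2 -EFinM -EFinD.
  by congr EFin; rewrite exprS; ring.
rewrite -intb /=; apply: ae_ge0_le_integral => //.
- by move=> w _; exact: iter_transition_ge0.
- by apply: measurable_section; exact: measurable_iter_transition.
- by move=> w _; exact: adde_ge0.
apply: ae_sub ae_W => w Ww _; rewrite /b !indicE in_setC.
have Xx' := X_inv Xx Ww.
have [sw|nsw] := boolP (w \in small); last first.
  by rewrite mule0 add0e; exact: iter_outside_le1.
rewrite mule1 adde0; apply: IH => //.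
have := v_descent Xx nXfx Ww (set_mem sw).
move/le_lt_trans => /(_ _ vx).
rewrite -lteBrDr// => /lt_le_trans; apply.
by rewrite -EFinB lee_fin -natr1 mulrDl mul1r addrK.
Qed.

End Hitting.
End Invariant.
End Chain.

Section RealSequences.
Context {R : realType}.

(** Let S be the sum of the first k terms.  Shifting it by one block gives
    S <= K + (1 - r) S. *)
Lemma geometric_blocks (t : nat -> R) K r : (forall i, 0 <= t i <= 1) -> 0 < r ->
  (forall i, t (K + i)%N <= (1 - r) * t i) ->
  forall k, \sum_(i < k) t i <= K%:R / r.
Proof.
move=> t01 r0 tK k.
have t0 i : 0 <= t i by case/andP: (t01 i).
have H : \sum_(i < k) t i <= K%:R + (1 - r) * \sum_(i < k) t i.
  apply: (@le_trans _ _ (\sum_(i < K + k) t i)).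
    by rewrite addnC big_split_ord /= lerDl sumr_ge0.
  rewrite big_split_ord /= lerD//.
    rewrite -[leRHS]mulr1 mulr_natl -[in leRHS](card_ord K) -sumr_const.
    by apply: ler_sum => i _; case/andP: (t01 i).
  by rewrite mulr_sumr; apply: ler_sum => i _; exact: tK.
rewrite ler_pdivlMr//; move: H; rewrite mulrBl mul1r mulrC => H; lra.
Qed.

(** The energies [a] stay bounded, as the cost [l] takes away at least the
    fraction [alpha] of them at each step; the balance then telescopes to a sum
    that differs from k tau by a bounded amount. *)
Lemma average_limit (a l c : nat -> R) tau alpha L :
  (forall k, 0 <= a k) -> (forall k, 0 <= c k) ->
  0 < alpha <= 1 -> (forall k, alpha * a k <= l k) -> 0 <= tau ->
  (forall k, \sum_(i < k) c i <= L) ->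
  (forall k, a k.+1 + l k = a k + c k + tau) ->
  k%:R^-1 * (\sum_(i < k) l i) @[k --> \oo] --> tau.
Proof.
move=> a0 c0 /andP[al0 al1] al tau0 cL E.
have cl k : c k <= L.
  apply: le_trans (cL k.+1); rewrite big_ord_recr /= lerDr sumr_ge0//.
have L0 : 0 <= L by apply: le_trans (cl 0%N).
(* Invariant level: above (L + tau) / alpha the energy decreases. *)
pose b := a 0%N + (L + tau) / alpha.
have H0 : 0 <= (L + tau) / alpha by rewrite divr_ge0 ?addr_ge0// ltW.
have b0 : 0 <= b by rewrite addr_ge0.
have ab k : a k <= b.
  elim: k => [|k IH]; first by rewrite lerDl.
  have : a k.+1 <= (1 - alpha) * a k + L + tau.
    by have := E k; have := al k; have := cl k; lra.
  move=> /le_trans; apply.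
  have : (1 - alpha) * a k <= (1 - alpha) * b by rewrite ler_wpM2l// subr_ge0.
  have : L + tau <= alpha * b.
    by rewrite /b mulrDr mulrCA divff ?gt_eqF// mulr1 lerDr mulr_ge0// ltW.
  lra.
have S k : \sum_(i < k) l i = a 0%N - a k + \sum_(i < k) c i + k%:R * tau.
  elim: k => [|k IH]; first by rewrite !big_ord0 subrr mul0r !addr0.
  rewrite !big_ord_recr /= IH -natr1; have := E k; lra.
pose M := b + L.
have near_bound : \forall k \near \oo, tau - M * k%:R^-1 <=
    k%:R^-1 * (\sum_(i < k) l i) <= tau + M * k%:R^-1.
  near=> k.
  have k0 : (0 < k%:R :> R) by rewrite ltr0n; near: k; exact: nbhs_infty_gt.
  have -> : k%:R^-1 * (\sum_(i < k) l i) =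
      tau + (a 0%N - a k + \sum_(i < k) c i) * k%:R^-1.
    rewrite S mulrDr [_ * (k%:R * tau)]mulrA mulVf ?gt_eqF// mul1r; ring.
  have i0 : 0 <= k%:R^-1 :> R by rewrite invr_ge0 ltW.
  rewrite !lerD2l -mulNr !ler_wpM2r//.
  - have := ab 0%N; have := a0 k; have := cL k.
    by rewrite /M; lra.
  - have := ab k; have := a0 0%N.
    have : 0 <= \sum_(i < k) c i by apply: sumr_ge0.
    by rewrite /M; lra.
have cvM : M * k%:R^-1 @[k --> \oo] --> (0 : R).
  rewrite -[X in _ --> X](mulr0 M); apply: cvgMl_tmp.
  rewrite -(cvg_shiftS (fun k => k%:R^-1 : R)); exact: cvg_harmonic.
apply: (squeeze_cvgr near_bound).
  rewrite -[X in _ --> X](subr0 tau); apply: cvgB => //; exact: cvg_cst.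
rewrite -[X in _ --> X](addr0 tau); apply: cvgD => //; exact: cvg_cst.
Unshelve. all: by end_near. Qed.

End RealSequences.

(** * The closed loop *)

Section Performance.
Context {R : realType} {n m q N : nat}.
Variable D : mpc_data R n m q.
Local Notation A := (sysA D).
Local Notation B := (sysB D).
Local Notation G := (sysG D).
Local Notation K := (terminal_gain D).
Local Notation Qc := (costQ D).
Local Notation Rc := (costR D).
Local Notation Pc := (costP D).
Local Notation W := (disturbances D).
Local Notation X := (feasible_states N D).
Local Notation Xf := (terminal D).

Hypothesis pdQ : pdmx Qc.
Hypothesis pdR : pdmx Rc.
Hypothesis psdP : psdmx Pc.
Hypothesis riccati : Pc = A^T *m Pc *m A
  - A^T *m Pc *m B *m invmx (Rc + B^T *m Pc *m B) *m B^T *m Pc *m A + Qc.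
Hypotheses (cW : closed W) (cZ : closed (constraints D)) (cXf : closed Xf).
Hypotheses (bW : bounded_set W) (bU : bounded_set (inputs D)).
Hypothesis ZU : forall x u, constraints D (x, u) -> inputs D u.
Hypothesis W_int : (W°)%classic 0.
Hypothesis Xf_int : (Xf°)%classic 0.
Hypothesis hterm : forall x w, Xf x -> W w ->
  constraints D (x, K *m x) /\ Xf ((A + B *m K) *m x + G *m w).
Hypothesis X_or : bounded_set X \/ Xf = [set: 'cV[R]_n].

Let psdQ : psdmx Qc := pdmx_psd pdQ.

Variables (d : R * 'M[R]_q) (kap : 'cV[R]_n -> 'cV[R]_m).
Hypotheses (admd : admissible W d) (ctrl : control_law N D d kap).

Variables (P : probability (famRn R q nat) R) (rho : probability (borelRn R q) R).
Hypothesis indP : independent_coords P.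
Hypothesis zm_rho : zero_mean_on W rho.
Hypothesis rho_small : forall e : R, 0 < e ->
  (0 < rho [set w | (norm2 w <= e)%R])%E.
Hypothesis law_P : forall k (S : set (borelRn R q)), measurable S ->
  marginal P k S = rho S.

(** An extension of the control law from the feasible states, which form a
    closed and hence Borel set, so that the closed loop is a Markov chain on the
    whole space. *)
Definition total_law : borelRn R n -> borelRn R m :=
  (kap : borelRn R n -> borelRn R m) \_ X.

Lemma total_lawE x : X x -> total_law x = kap x.
Proof. by move=> Xx; rewrite /total_law patchE mem_set. Qed.

Lemma measurable_total_law : measurable_fun setT total_law.
Proof.
have mX : measurable (X : set (borelRn R n)).
  by apply: closed_borel; exact: feasible_states_closed.
by apply/(measurable_restrictT _ mX); case: ctrl.
Qed.

Definition nominal_step (x : 'cV[R]_n) : 'cV[R]_n := A *m x + B *m total_law x.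

Lemma measurable_nominal_step :
  measurable_fun setT (nominal_step : borelRn R n -> borelRn R n).
Proof.
apply: measurable_vecD; apply: measurable_vecM; first exact: measurable_id.
exact: measurable_total_law.
Qed.

Lemma feasible_optimal x : X x -> exists2 th : policy R m q N,
  optimal_policies D d x th & total_law x = th.2 ord0.
Proof. by move=> Xx; case: ctrl => _ _ /(_ _ Xx); rewrite total_lawE. Qed.

(** The tail of the optimal policy is feasible at the next state. *)
Lemma feasible_step x w : X x -> W w -> X (step nominal_step G x w).
Proof.
move=> Xx Ww; have [th [F _] e] := feasible_optimal Xx.
have [th' tl] := tail_policy D x th w.
exists th'; rewrite /step /nominal_step e; exact: (feasible_tail hterm F Ww tl).
Qed.

Lemma total_law_terminal x : Xf x -> total_law x = K *m x.
Proof.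
move=> Xx; have [th opt ->] := feasible_optimal (terminal_feasible (N := N) hterm Xx).
exact: (terminal_optimal psdQ pdR psdP riccati cW bW hterm admd).
Qed.

(** Optimal inputs coincide with the terminal gain there, which is assumed to
    leave the terminal set invariant. *)
Lemma terminal_step x w : Xf x -> W w -> Xf (step nominal_step G x w).
Proof.
move=> Xx Ww; rewrite /step /nominal_step total_law_terminal//.
by have [_] := terminal_next hterm Xx Ww.
Qed.

Lemma closed_loop_trajectory x w k : X x -> (forall i, W (w i)) ->
  closed_loop D kap x w k = trajectory nominal_step G x w k /\
  X (trajectory nominal_step G x w k).
Proof.
move=> Xx Ww; elim: k => [//|k [IH Xk]] /=; split; last exact: feasible_step.
by rewrite IH /step /nominal_step total_lawE.
Qed.

Definition running_cost (x : borelRn R n) : \bar R := (stage_cost D x (total_law x))%:E.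
Definition running_deviation (x : borelRn R n) : \bar R :=
  (deviation D x (total_law x))%:E.
Definition energy (x : borelRn R n) : \bar R := (qform Pc x)%:E.
Definition mean_noise_cost : R := Ex rho (fun w : borelRn R q => noise_cost D w).

Local Notation T := (transition nominal_step G rho).

Lemma measurable_running_cost : measurable_fun setT running_cost.
Proof.
apply/measurable_EFinP; apply: measurable_funD; apply: measurable_qform.
  exact: measurable_id.
exact: measurable_total_law.
Qed.

Lemma measurable_running_deviation : measurable_fun setT running_deviation.
Proof.
apply/measurable_EFinP; apply: measurable_qform.
rewrite (_ : (fun _ => _) = fun x : borelRn R n =>
  (total_law x : 'cV[R]_m) + (- K) *m (x : 'cV[R]_n)).
  apply: measurable_vecD; first exact: measurable_total_law.
  by apply: measurable_vecM; exact: measurable_id.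
by apply/funext => x; congr (_ + _); exact/esym/mulNmx.
Qed.

Lemma measurable_energy : measurable_fun setT energy.
Proof.
by apply/measurable_EFinP; apply: measurable_qform; exact: measurable_id.
Qed.

Lemma running_cost_ge0 x : (0 <= running_cost x)%E.
Proof. by rewrite lee_fin; exact: stage_cost_ge0. Qed.

Lemma running_deviation_ge0 x : (0 <= running_deviation x)%E.
Proof. by have [_ S0] := psd_input_weight pdR psdP; rewrite lee_fin; exact: S0. Qed.

Lemma energy_ge0 x : (0 <= energy x)%E.
Proof. by rewrite lee_fin; case: psdP. Qed.

Let ae_rho : {ae rho, forall w, W w} := ae_disturbance cW zm_rho.

Lemma mean_noise_cost_ge0 : 0 <= mean_noise_cost.
Proof.
apply: (Ex_ge0 ae_rho); first by apply: bounded_qform; exact: bounded_id.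
by move=> w _; exact: noise_cost_ge0.
Qed.

Lemma mean_noise_costE i :
  mean_noise_cost = \tr (G^T *m Pc *m G *m second_moment (marginal P i)).
Proof.
rewrite (eq_law_moment (law_P i)) /mean_noise_cost /noise_cost.
set M := _ *m G.
rewrite (_ : (fun _ => _) = fun w : borelRn R q =>
    \sum_j \sum_i M i j * ((w : 'cV[R]_q) i 0 * (w : 'cV[R]_q) j 0)); last first.
  apply/funext => w; rewrite qform_sum; apply: eq_bigr => j _.
  by apply: eq_bigr => k _; ring.
have bw (j k : 'I_q) : bounded_on (W : set (borelRn R q)) (fun w : borelRn R q =>
    (w : 'cV[R]_q) k 0 * (w : 'cV[R]_q) j 0).
  by apply: bounded_onM; exact: bounded_id.
have bMw (j k : 'I_q) : bounded_on (W : set (borelRn R q)) (fun w : borelRn R q =>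
    M k j * ((w : 'cV[R]_q) k 0 * (w : 'cV[R]_q) j 0)).
  by apply: bounded_onM => //; exact: bounded_on_cst.
rewrite (Ex_sum ae_rho); last by move=> j; exact: bounded_on_sum.
under eq_bigr => j _ do rewrite (Ex_sum ae_rho)//.
rewrite exchange_big /= /mxtrace; apply: eq_bigr => k _.
rewrite [RHS]mxE; apply: eq_bigr => j _.
rewrite (ExZ ae_rho)//; congr (_ * _); rewrite [RHS]mxE.
rewrite (_ : (fun w : borelRn R q => (_ *m _) _ _) = fun w : borelRn R q =>
  (w : 'cV[R]_q) j 0 * (w : 'cV[R]_q) k 0); last first.
  by apply/funext => w; rewrite mxE big_ord1 mxE.
rewrite (expectationE ae_rho)//=; congr Ex; apply/funext => w; exact: mulrC.
Qed.

(** One step of the closed loop trades energy for running cost, up to the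
    deviation from the terminal gain and the cost of the noise. *)
Lemma energy_balance x :
  (T energy x + running_cost x =
   energy x + running_deviation x + mean_noise_cost%:E)%E.
Proof.
pose y := nominal_step x.
have bn : bounded_on (W : set (borelRn R q)) (fun w : borelRn R q => noise_cost D w).
  by apply: bounded_qform; exact: bounded_id.
have bc : bounded_on (W : set (borelRn R q)) (fun w : borelRn R q =>
    (y^T *m (Pc *m G) *m (w : 'cV[R]_q)) 0 0).
  by apply: bounded_form; [exact: bounded_vec_cst|exact: bounded_id].
have b2c : bounded_on (W : set (borelRn R q)) (fun w : borelRn R q =>
    2 * (y^T *m (Pc *m G) *m (w : 'cV[R]_q)) 0 0).
  by apply: bounded_onM => //; exact: bounded_on_cst.
have bcst : bounded_on (W : set (borelRn R q)) (fun w : borelRn R q => qform Pc y).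
  exact: bounded_on_cst.
have bsum := bounded_onD bcst b2c.
have -> : T energy x = (qform Pc y + mean_noise_cost)%:E.
  rewrite /transition /energy /step -/y.
  under eq_integral do rewrite qform_next//.
  rewrite (integralEx ae_rho); last exact: bounded_onD.
  rewrite (ExD ae_rho)// (ExD ae_rho)// Ex_cst (ExZ ae_rho)//.
  by rewrite (Ex_form0 cW bW zm_rho) mulr0 addr0.
rewrite /running_cost /energy /running_deviation -!EFinD; congr EFin.
rewrite -(completion_of_squares pdR psdP riccati) -/y /y /nominal_step; ring.
Qed.

(** The state cost alone dominates a fraction of the energy, as Q is definite. *)
Lemma running_cost_coercive : exists2 alpha : R, 0 < alpha <= 1 &
  forall x, (alpha%:E * energy x <= running_cost x)%E.
Proof.
have [c c0 cQ] := pdmx_lower pdQ.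
pose e := n%:R * (n%:R * `|Pc|); have e0 : 0 <= e by rewrite !mulr_ge0.
have s0 : 0 < c + e + 1 by lra.
exists (c / (c + e + 1)).
  by rewrite divr_gt0//= ler_pdivrMr// mul1r; lra.
move=> x; rewrite -EFinM lee_fin.
have qP : qform Pc x <= e * `|x| ^+ 2.
  by rewrite (le_trans (ler_norm _))// qform_le_norm.
have qR : 0 <= qform Rc (total_law x) by case: (pdmx_psd pdR).
have qQ := cQ x.
apply: (@le_trans _ _ (c * `|x| ^+ 2)); last by rewrite /stage_cost; lra.
rewrite mulrAC ler_pdivrMr// -mulrA ler_wpM2l ?(ltW c0)//.
apply: (le_trans qP); rewrite mulrC ler_wpM2l ?sqr_ge0//; lra.
Qed.

(** ** Hitting the terminal set *)

Lemma measurable_small e : 0 <= e ->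
  measurable ([set w | (norm2 w <= e)%R] : set (borelRn R q)).
Proof.
move=> e0.
rewrite (_ : mkset _ = (fun w : borelRn R q => qform 1%:M (w : 'cV[R]_q)) @^-1` `]-oo, e ^+ 2]).
  have := measurable_qform (1%:M : 'M[R]_q) (@measurable_id _ (borelRn R q) setT).
  move=> /(_ measurableT _ (measurable_itv `]-oo, e ^+ 2])).
  by rewrite setTI.
apply/seteqP; split=> w /=; rewrite in_itv /= /norm2 qform1 => H.
  by rewrite -[leLHS]sqr_sqrtr ?ler_sqr ?nnegrE ?sqrtr_ge0// sumr_ge0// => i _; exact: sqr_ge0.
by rewrite -(ler_sqr (sqrtr_ge0 _)) ?nnegrE// sqr_sqrtr// sumr_ge0// => i _; exact: sqr_ge0.
Qed.

Lemma norm_le_norm2 (w : 'cV[R]_q) : `|w| <= norm2 w.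
Proof.
apply: mx_norm_le => [|i j]; first exact: sqrtr_ge0.
rewrite ord1 -sqrtr_sqr ler_wsqrtr// (bigD1 i)//= lerDl.
by apply: sumr_ge0 => k _; exact: sqr_ge0.
Qed.

(** Outside the terminal set the state is bounded away from the origin. *)
Lemma outside_cost : exists2 eta : R, 0 < eta &
  forall x u, ~ Xf x -> eta <= stage_cost D x u.
Proof.
have [c c0 cQ] := pdmx_lower pdQ.
have : nbhs (0 : 'cV[R]_n) Xf by exact: Xf_int.
move=> /nbhs_normP[e /= e0 eXf]; exists (c * e ^+ 2).
  by rewrite mulr_gt0// exprn_gt0.
move=> x u nXf.
have ex : e <= `|x|.
  by rewrite leNgt; apply/negP => xe; apply: nXf; apply: eXf; rewrite /ball_ /= sub0r normrN.
have qR : 0 <= qform Rc u by case: (pdmx_psd pdR).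
have : c * e ^+ 2 <= c * `|x| ^+ 2.
  by rewrite ler_wpM2l ?(ltW c0)// ler_sqr ?nnegrE ?(ltW e0).
have := cQ x; rewrite /stage_cost; lra.
Qed.

(** The value lies between 0 and the uniform bound M on horizon costs, and each
    small disturbance outside the terminal set lowers it by [eta].  Hence about
    M / eta small disturbances in a row lead to the terminal set, and the
    probability of that many depends on neither the state nor the time. *)
Lemma uniform_hitting : bounded_set X -> exists K0 (r : R), 0 < r <= 1 /\
  forall x, X x -> (iter K0 T (outside Xf) x <= (1 - r)%:E)%E.
Proof.
move=> bX.
have [M M0 MJ] := horizon_cost_bound (N := N) bW bX bU ZU.
have [eta2 eta20 out] := outside_cost.
pose eta := eta2 / 2; have eta0 : 0 < eta by rewrite divr_gt0.
have [r r0 rW] := disturbance_ball W_int.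
have s0 : 0 < M + eta by lra.
(* Disturbances below r t are t times possible ones, for which [value_descent]
   loses at most t M, at most half of the stage cost. *)
pose t := eta / (M + eta).
have t0 : 0 < t by rewrite divr_gt0.
have t1 : t <= 1 by rewrite ler_pdivrMr// mul1r; lra.
have tM : t * M <= eta.
  by rewrite mulrAC ler_pdivrMr// ler_wpM2l ?(ltW eta0)//; lra.
pose small := [set w : borelRn R q | (norm2 (w : 'cV[R]_q) <= r * t)%R].
have rt0 : 0 < r * t by rewrite mulr_gt0.
have msmall : measurable small by apply: measurable_small; exact: ltW.
pose v x := value (N := N) D d x.
have v0 x : (0 <= v x)%E by exact: (value_ge0 psdQ pdR psdP cW bW admd).
have descent x w : X x -> ~ Xf x -> W w -> small w ->
    (v (step nominal_step G x w) + eta%:E <= v x)%E.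
  move=> Xx nXf Ww sw; have [th opt e] := feasible_optimal Xx.
  pose w1 := t^-1 *: (w : 'cV[R]_q).
  have wE : w = t *: w1 by rewrite scalerA divff ?gt_eqF// scale1r.
  have Ww1 : W w1.
    apply: rW; rewrite normrZ gtr0_norm ?invr_gt0// ler_pdivrMl// mulrC.
    exact: le_trans (norm_le_norm2 _) sw.
  have := value_descent psdQ pdR psdP riccati cW bW hterm (t := t) (w1 := w1) (M := M) opt.
  rewrite -wE -e => /(_ _ Ww1 _ Ww) H.
  have {}H : (v (step nominal_step G x w) + (stage_cost D x (total_law x))%:E <=
      v x + (t * M)%:E)%E.
    apply: H; last by rewrite t1 ltW.
    by move=> y th' w' Xy F' Ww'; exact: MJ.
  have so := out x (total_law x) nXf.
  have : (v (step nominal_step G x w) + eta2%:E <= v x + eta%:E)%E.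
    apply: (@le_trans _ _ (v (step nominal_step G x w) + (stage_cost D x (total_law x))%:E)%E).
      by rewrite leeD2l// lee_fin.
    by apply: (le_trans H); rewrite leeD2l// lee_fin.
  have -> : eta2 = eta + eta by rewrite /eta -splitr.
  by rewrite EFinD addeA leeD2rE.
pose p := fine (rho small).
have pE : rho small = p%:E by rewrite fineK// fin_num_measure.
have p0 : 0 < p by rewrite -lte_fin -pE; exact: rho_small.
have p1 : p <= 1 by rewrite -lee_fin -pE probability_le1.
pose K0 := (Num.trunc (M / eta)).+1.
exists K0, (p ^+ K0); split.
  by rewrite exprn_gt0// exprn_ile1// ltW.
move=> x Xx.
apply: (hitting_probability measurable_nominal_step cW _ feasible_step
  cXf terminal_step msmall v0 descent) => //.
  by have [] := zm_rho.
have [th opt _] := feasible_optimal Xx.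
apply: (@le_lt_trans _ _ M%:E).
  rewrite /v (value_optimal opt).
  apply: (worst_cost_bound cW bW) => // w Ww.
  by apply: MJ => //; case: opt.
rewrite lte_fin -ltr_pdivrMr// truncnS_gt// divr_ge0// ltW.
Qed.

Lemma deviation_bound : bounded_set X -> exists2 C : R, 0 <= C &
  forall x, X x -> (running_deviation x <= C%:E * outside Xf x)%E.
Proof.
move=> bX.
have [Mx Mx0 MX] := bounded_set_bound bX.
have [Mu Mu0 MU] := bounded_set_bound bU.
pose c := m%:R * (m%:R * `|input_weight D|).
have c0 : 0 <= c by rewrite !mulr_ge0.
pose b := Mu + n%:R * `|K| * Mx.
exists (c * b ^+ 2); first by rewrite mulr_ge0// sqr_ge0.
move=> x Xx; have [Xfx|nXf] := pselect (Xf x).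
  rewrite /running_deviation total_law_terminal// /deviation subrr qform0.
  by rewrite mule_ge0 ?outside_ge0// lee_fin mulr_ge0// sqr_ge0.
rewrite /outside indicE mem_set// mule1 lee_fin.
rewrite (le_trans (ler_norm _))// (le_trans (qform_le_norm _ _))//.
rewrite ler_wpM2l// ler_sqr ?nnegrE//; last first.
  by rewrite addr_ge0// !mulr_ge0.
rewrite (le_trans (ler_normB _ _))// lerD//.
  by apply: MU; rewrite total_lawE//; case: ctrl => _ /(_ _ Xx).
by rewrite (le_trans (mulmx_norm_le _ _))// ler_wpM2l ?mulr_ge0// MX.
Qed.

Let rhoW : rho W = 1%E. Proof. by case: zm_rho. Qed.
Let mf := measurable_nominal_step.

(** The deviation vanishes on the terminal set and is bounded elsewhere, so its
    expectation is at most a multiple of the probability of being outside, which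
    decays geometrically over blocks of [K0] steps. *)
Lemma deviation_summable x : X x -> exists L : R, forall k,
  (\sum_(i < k) iter i T running_deviation x <= L%:E)%E.
Proof.
move=> Xx; have mdev := measurable_running_deviation.
have mo := measurable_outside cXf.
case: X_or => [bX|XfT]; last first.
  exists 0 => k; rewrite big1// => i _.
  have -> : running_deviation = (fun=> 0%:E).
    apply/funext => y; rewrite /running_deviation total_law_terminal ?XfT//.
    by rewrite /deviation subrr qform0.
  exact: iter_transition_cst.
have [C C0 devC] := deviation_bound bX.
have [K0 [r [/andP[r0 r1] hit]]] := uniform_hitting bX.
have le1 i := iter_outside_le1 mf cW rhoW feasible_step cXf i Xx.
pose t i := fine (iter i T (outside Xf) x).
have tE i : iter i T (outside Xf) x = (t i)%:E.
  rewrite fineK// ge0_fin_numE; first exact: le_lt_trans (le1 i) (ltry _).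
  exact: iter_transition_ge0 (outside_ge0 Xf) _.
have t01 i : 0 <= t i <= 1.
  rewrite -!lee_fin -tE le1 andbT.
  exact: iter_transition_ge0 (outside_ge0 Xf) _.
have tK i : t (K0 + i)%N <= (1 - r) * t i.
  rewrite -lee_fin EFinM -!tE addnC iterD.
  rewrite -(iter_transitionZ G mf rho)//; [|exact: outside_ge0|by rewrite subr_ge0].
  have moK := measurable_iter_transition G mf rho K0 mo (outside_ge0 Xf).
  apply: (iter_transition_le mf cW rhoW feasible_step) => //.
  - exact: iter_transition_ge0 (outside_ge0 Xf).
  - exact: measurable_funeM.
  - by move=> y; rewrite mule_ge0 ?outside_ge0// lee_fin subr_ge0.
  - move=> y Xy; have [Xfy|nXfy] := pselect (Xf y).
      rewrite (iter_outside_terminal mf cW rhoW cXf terminal_step)//.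
      by rewrite mule_ge0 ?outside_ge0// lee_fin subr_ge0.
    by rewrite {2}/outside indicE mem_set// mule1; exact: hit.
have geo := geometric_blocks t01 r0 tK.
exists (C * (K0%:R / r)) => k.
apply: (@le_trans _ _ (\sum_(i < k) (C * t i)%:E)%E).
  apply: lee_sum => i _; rewrite EFinM -tE -(iter_transitionZ G mf rho)//; last exact: outside_ge0.
  apply: (iter_transition_le mf cW rhoW feasible_step) => //.
  - exact: running_deviation_ge0.
  - exact: measurable_funeM.
  - by move=> y; rewrite mule_ge0 ?outside_ge0// lee_fin.
by rewrite sumEFin lee_fin -mulr_sumr ler_wpM2l.
Qed.

(** ** Average costs *)

Let zmP i : zero_mean_on W (marginal P i) := eq_law_zero_mean (law_P i) cW zm_rho.

(** The defining integral runs over an event of full measure, on which the closed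
    loop agrees with the chain of the extended law. *)
Lemma average_costE x k : X x -> average_cost D kap P x k =
  ((k%:R^-1)%:E * \sum_(i < k) iter i T running_cost x)%E.
Proof.
move=> Xx; rewrite /average_cost.
pose g i (w : famRn R q nat) := running_cost (trajectory nominal_step G x w i).
have mg i : measurable_fun setT (g i).
  exact: (measurableT_comp measurable_running_cost (measurable_trajectory G mf x i)).
have g0 i w : (0 <= g i w)%E by exact: running_cost_ge0.
have mOm := measurable_in_all (I := nat) cW.
have k0 : 0 <= k%:R^-1 :> R by rewrite invr_ge0.
pose h w := ((k%:R^-1)%:E * \sum_(i < k) g i w)%E.
have ms : measurable_fun setT (fun w => \sum_(i < k) g i w)%E.
  by apply: emeasurable_sum => i.
transitivity (\int[P]_(w in in_all W) h w)%E.
  apply: eq_integral => w /set_mem Ww.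
  rewrite EFinM -sumEFin; congr (_ * _)%E; apply: eq_bigr => i _.
  have [-> Xi] := closed_loop_trajectory i Xx Ww.
  by rewrite /g /running_cost total_lawE.
transitivity (\int[P]_w h w)%E.
  have PN : P (~` in_all W) = 0%E.
    have := ae_in_all cW zmP; rewrite /almost_everywhere => H.
    by apply/(negligibleP P) => //; exact: measurableC.
  rewrite [RHS](ge0_negligible_integral _ _ _ _ PN)//.
  - by rewrite setTD setCK.
  - exact: measurableC.
  - exact: measurable_funeM.
  - by move=> w _; rewrite mule_ge0 ?lee_fin// sume_ge0.
rewrite /h ge0_integralZl_EFin//; last by move=> w _; rewrite sume_ge0.
rewrite ge0_integral_sum//; congr (_ * _)%E; apply: eq_bigr => i _.
apply: (@expectation_trajectory R n q nominal_step G mf rho P running_cost x i) => //.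
- exact: measurable_running_cost.
- exact: running_cost_ge0.
Qed.

Lemma average_cost_cvg x : X x ->
  average_cost D kap P x k @[k --> \oo] --> mean_noise_cost%:E.
Proof.
move=> Xx; have mdev := measurable_running_deviation.
have men := measurable_energy; have mrc := measurable_running_cost.
have [L dL] := deviation_summable Xx.
have [alpha al01 coer] := running_cost_coercive.
have al0 : 0 <= alpha by case/andP: al01 => /ltW.
have dev0 i : (0 <= iter i T running_deviation x)%E.
  by apply: iter_transition_ge0; exact: running_deviation_ge0.
have en0 i : (0 <= iter i T energy x)%E.
  by apply: iter_transition_ge0; exact: energy_ge0.
have rc0 i : (0 <= iter i T running_cost x)%E.
  by apply: iter_transition_ge0; exact: running_cost_ge0.
have bal i : (iter i.+1 T energy x + iter i T running_cost x =
    iter i T energy x + iter i T running_deviation x + mean_noise_cost%:E)%E.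
  have mT := measurable_transition G mf rho men energy_ge0.
  rewrite iterSr -(iter_transitionD G mf rho)//; first last.
  - exact: running_cost_ge0.
  - exact: transition_ge0 energy_ge0.
  rewrite (_ : (fun y => T energy y + running_cost y)%E =
     (fun y => energy y + running_deviation y + mean_noise_cost%:E)%E); last first.
    by apply/funext => y; exact: energy_balance.
  rewrite (iter_transitionD G mf rho (h := fun y => (energy y + running_deviation y)%E)
     (h' := fun=> mean_noise_cost%:E))//.
  - rewrite iter_transition_cst (iter_transitionD G mf rho)//.
      exact: energy_ge0.
    exact: running_deviation_ge0.
  - exact: emeasurable_funD.
  - by move=> y; rewrite adde_ge0 ?energy_ge0 ?running_deviation_ge0.
  - by move=> y; rewrite lee_fin mean_noise_cost_ge0.
have fdev i : iter i T running_deviation x \is a fin_num.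
  rewrite ge0_fin_numE//; apply: le_lt_trans (ltry L); apply: le_trans (dL i.+1).
  by rewrite big_ord_recr /= leeDr// sume_ge0.
have fen i : iter i T energy x \is a fin_num.
  elim: i => [//|i IH]; rewrite ge0_fin_numE//.
  apply: (@le_lt_trans _ _ (iter i.+1 T energy x + iter i T running_cost x)%E).
    by rewrite leeDl.
  by rewrite bal -ge0_fin_numE ?adde_ge0 ?lee_fin ?mean_noise_cost_ge0// !fin_numD IH fdev.
have frc i : iter i T running_cost x \is a fin_num.
  rewrite ge0_fin_numE//.
  apply: (@le_lt_trans _ _ (iter i.+1 T energy x + iter i T running_cost x)%E).
    by rewrite leeDr.
  by rewrite bal -ge0_fin_numE ?adde_ge0 ?lee_fin ?mean_noise_cost_ge0// !fin_numD fen fdev.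
pose a i := fine (iter i T energy x); pose l i := fine (iter i T running_cost x).
pose c i := fine (iter i T running_deviation x).
have aE i : iter i T energy x = (a i)%:E by rewrite fineK.
have lE i : iter i T running_cost x = (l i)%:E by rewrite fineK.
have cE i : iter i T running_deviation x = (c i)%:E by rewrite fineK.
apply: (@cvg_trans _ ((k%:R^-1 * \sum_(i < k) l i)%:E @[k --> \oo])).
  apply: near_eq_cvg; near=> k.
  rewrite average_costE// EFinM; congr (_ * _)%E; rewrite -sumEFin.
  by apply: eq_bigr => i _; rewrite lE.
apply/fine_cvgP; split; first exact: nearW.
apply: (@average_limit R a l c mean_noise_cost alpha L) => //.
- by move=> i; rewrite fine_ge0.
- by move=> i; rewrite fine_ge0.
- move=> i; rewrite -lee_fin EFinM -aE -lE -(iter_transitionZ G mf rho)//; last exact: energy_ge0.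
  apply: (iter_transition_le mf cW rhoW feasible_step) => //.
  + exact: measurable_funeM.
  + by move=> y; rewrite mule_ge0 ?energy_ge0// lee_fin.
  + exact: running_cost_ge0.
- exact: mean_noise_cost_ge0.
- move=> k; rewrite -lee_fin -sumEFin; apply: le_trans (dL k).
  by under eq_bigr do rewrite -cE.
- move=> i; apply: EFin_inj; rewrite !EFinD -!aE -lE -cE; exact: bal.
Unshelve. all: by end_near. Qed.

End Performance.

Theorem theorem3p5 (R : realType) (n m q N : nat)
  (A : 'M[R]_n) (B : 'M[R]_(n, m)) (G : 'M[R]_(n, q))
  (U : set 'cV[R]_m) (W : set 'cV[R]_q)
  (Z : set ('cV[R]_n * 'cV[R]_m)) (Xf : set 'cV[R]_n)
  (Qc : 'M[R]_n) (Rc : 'M[R]_m) (Pc : 'M[R]_n)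
  (D := MpcData A B G U W Z Xf Qc Rc Pc)
  (X := feasible_states N D)
  (Kf := terminal_gain D)
  (hZU : forall x u, Z (x, u) -> U u)
  (kappa : R * 'M[R]_q -> 'cV[R]_n -> 'cV[R]_m)
  (hkappa : forall d, admissible W d -> control_law N D d (kappa d))
  (hclosed : [/\ closed U, closed W, closed Z & closed Xf])
  (hconvex : [/\ convex_set U, convex_set W, convex_set Z & convex_set Xf])
  (horigin : [/\ U 0, W 0, Z 0 & Xf 0])
  (hbounded : bounded_set U /\ bounded_set W)
  (hWint : W° 0)
  (hpsd : [/\ psdmx Qc, psdmx Rc & psdmx Pc])
  (hQpd : pdmx Qc)
  (hXbounded : bounded_set X \/ Xf = [set: 'cV[R]_n])
  (hpd : pdmx Rc /\ pdmx Pc)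
  (hriccati : Pc = A^T *m Pc *m A
     - A^T *m Pc *m B *m invmx (Rc + B^T *m Pc *m B) *m B^T *m Pc *m A + Qc)
  (hterminal : forall x w, Xf x -> W w ->
     Z (x, Kf *m x) /\ Xf ((A + B *m Kf) *m x + G *m w))
  (hXfint : Xf° 0) :
  forall (x : 'cV[R]_n) (d : R * 'M[R]_q) (P : probability (famRn R q nat) R),
    X x -> admissible W d -> iid_disturbances W P ->
    forall i : nat,
      average_cost D (kappa d) P x k @[k --> \oo]
        --> (\tr (G^T *m Pc *m G *m second_moment (marginal P i)))%:E.
Proof.
move=> x d P Xx admd [indP [rho [zm_rho rho_small law_P]]] i.
have [cU cW cZ cXf] := hclosed; have [bU bW] := hbounded.
have [pdR pdP] := hpd; have psdP := pdmx_psd pdP.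
rewrite -(mean_noise_costE (D := D) cW bW zm_rho law_P i).
exact: (average_cost_cvg (D := D) hQpd pdR psdP hriccati cW cZ cXf bW bU hZU hWint hXfint
  hterminal hXbounded admd (hkappa d admd) indP zm_rho rho_small law_P Xx).
Qed.
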